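(* Let $K_1$ be a long virtual knot diagram such that the corresponding compact virtual knot diagram $Cl(K_1)$ is good. Then $K_1$ is minimal in the long category: every long virtual knot diagram equivalent to $K_1$ (as a long virtual knot diagram) has at least as many classical crossings as $K_1$.
   Context: A virtual link diagram is a generic immersion of circles in the plane in which each double point is either a classical crossing (with over/under information) or a virtual crossing (without such information). Virtual links are equivalence classes of virtual link diagrams under planar isotopy and generalized Reidemeister moves: the classical Reidemeister moves, the purely virtual versions of the three Reidemeister moves, and the mixed third move in which an arc containing only virtual crossings passes across a classical crossing (equivalently, the classical Reidemeister moves together with the detour move). A long virtual knot diagram is the analogous diagram of an oriented immersed line in the plane which coincides with a fixed straight line outside a compact set (i.e. with fixed endpoints at infinity). Two long virtual knot diagrams are equivalent if they are related by planar isotopies and generalized Reidemeister moves, all performed inside a compact part of the plane. The compact virtual knot diagram $Cl(K_1)$ is the closure of $K_1$, obtained by joining its two ends by an arc outside the compact part, with no new classical crossings. The atom $V(L)$ of a virtual diagram $L$. An atom is a pair $(M,\Gamma)$, where $M$ is a connected closed $2$-manifold (not necessarily orientable) and $\Gamma\subset M$ is an embedded $4$-valent graph (the frame) whose complement $M\setminus\Gamma$ is a union of $2$-cells with a fixed black/white checkerboard colouring. The atom $V(L)$ is constructed as follows. The frame $\Gamma$ has one vertex for each classical crossing of $L$, and its edges correspond to the arcs of $L$ connecting classical crossings (these arcs may pass through virtual crossings, which are ignored), so that the four edge-ends at a vertex are the four branches emanating from the crossing. At each classical crossing $X$, enumerate the four emanating branches $x_1,x_2,x_3,x_4$ in clockwise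 order so that $x_1,x_3$ form the undercrossing and $x_2,x_4$ form the overcrossing. The black angles at $X$ are $(x_1,x_2)$ and $(x_3,x_4)$; the white angles are $(x_2,x_3)$ and $(x_4,x_1)$. The black $2$-cells are attached along the closed cycles in $\Gamma$ that follow edges and at each vertex turn through black angles; the white $2$-cells are attached along the closed cycles obtained in the same way from the white angles. Each vertex of $V(L)$ is thus incident to four pieces of cells, one for each of its four angles: two black and two white. Globally some of these pieces may belong to the same cell. The diagram $L$ is called good if at each vertex of $V(L)$ the four pieces belong to four pairwise different cells. *)

(* Defs.v *)
From mathcomp Require Import all_boot.
From Stdlib Require Import Relation_Operators.

Set Implicit Arguments.
Unset Strict Implicit.
Unset Printing Implicit Defensive.

(* Written with MathComp.

   Plane diagrams are recorded up to planar isotopy, as combinatorial maps on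
   the sphere S^2 = R^2 + infinity.

   The two strands through a double point are named [false] and [true] so that
   (direction of strand false, direction of strand true) is a positively
   oriented frame of the plane: drawing strand [false] from west to east,
   strand [true] runs from south to north.  A passage (c, s) is the moment at
   which the curve runs through the double point c along its strand s. *)

(* [Classical s]: strand s is the overcrossing one. *)
Inductive crossing_kind := Virtual | Classical of bool.

Definition is_classical (k : crossing_kind) : bool :=
  if k is Classical _ then true else false.

(* A branch at a double point is (s, out): the outgoing (out = true) or the
   incoming end of strand s.  Outgoing [false] is east, outgoing [true] north,
   incoming [false] west, incoming [true] south; the two functions below
   give the next branch in counterclockwise, resp. clockwise, order. *)
Definition ccw_branch (b : bool * bool) : bool * bool :=
  (~~ b.1, b.1 (+) b.2).
Definition cw_branch (b : bool * bool) : bool * bool :=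
  (~~ b.1, ~~ b.1 (+) b.2).

(* The curve is read from a base point [None] on it: the point at infinity of
   a long diagram, or an ordinary point at which a closed curve is cut.  A
   dart (p, out) is the half-edge leaving (out = true) or entering the site p. *)
Section Sphere.
Variables (X : finType) (w : seq (X * bool)).

Definition tour : seq (option (X * bool)) := None :: map Some w.

Definition dart : finType := (option (X * bool) * bool)%type.

Definition other_end (d : dart) : dart :=
  if d.2 then (next tour d.1, false) else (prev tour d.1, true).

Definition rotate (d : dart) : dart :=
  match d.1 with
  | Some (c, s) => let b := ccw_branch (s, d.2) in (Some (c, b.1), b.2)
  | None => (None, ~~ d.2)
  end.

Definition num_faces : nat := fcard (rotate \o other_end) predT.

(* Euler's formula V + F = E + 2.  With #|X| = n four-valent vertices and the
   two-valent base point, V = n + 1 and E = 2 n + 1. *)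
Definition spherical : Prop :=
  (#|X| + 1) + num_faces = (2 * #|X| + 1) + 2.

End Sphere.

(* A generically immersed oriented curve on the sphere with a base point,
   with classical or virtual double points, each passed exactly once along each
   of its two strands. *)
Record curve_diagram := CurveDiagram {
  crossing : finType;
  kind : crossing -> crossing_kind;
  passages : seq (crossing * bool);
  passages_once : perm_eq passages (enum {: crossing * bool});
  passages_spherical : spherical passages
}.

(* Long virtual knot diagrams: base point at infinity. *)
Record long_diagram := LongDiagram { long_curve :> curve_diagram }.

(* Compact virtual knot diagrams, cut at a point of an edge. *)
Record knot_diagram := KnotDiagram { closed_curve :> curve_diagram }.

(* The two ends are joined by an arc near infinity, which meets nothing; infinity
   becomes an ordinary point of the closed curve. *)
Definition Cl (K : long_diagram) : knot_diagram := KnotDiagram K.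

Definition classical_number (D : curve_diagram) : nat :=
  #|[pred c : crossing D | is_classical (kind c)]|.

(* [f] identifies the crossings of D with crossings of D' of the same kind. *)
Definition carries (D D' : curve_diagram) (f : crossing D -> crossing D') : Prop :=
  injective f /\ forall c, kind (f c) = kind c.

Definition rename (X Y : Type) (f : X -> Y) (w : seq (X * bool)) :
    seq (Y * bool) :=
  [seq (f p.1, p.2) | p <- w].

Definition planar_isotopy (D D' : curve_diagram) : Prop :=
  exists f : crossing D -> crossing D',
    carries f /\ passages D' = rename f (passages D).

(* First move, classical or virtual: D' has a new kink at c. *)
Definition reidemeister1 (D D' : curve_diagram) : Prop :=
  exists f : crossing D -> crossing D', carries f /\
  exists A B (c : crossing D') (s : bool),
    passages D = A ++ B /\
    passages D' = rename f A ++ [:: (c, s); (c, ~~ s)] ++ rename f B.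

(* Second move, classical or virtual: two arcs, running in the same or in
   opposite directions, overlap in a bigon with vertices a, b.  The orientations
   at a and b are opposite, so if one arc is over at both, then it is so along
   strands with different names. *)
Definition bigon_kinds (ka kb : crossing_kind) : bool :=
  match ka, kb with
  | Virtual, Virtual => true
  | Classical u, Classical v => u != v
  | _, _ => false
  end.

Definition reidemeister2 (D D' : curve_diagram) : Prop :=
  exists f : crossing D -> crossing D', carries f /\
  exists A B C (a b : crossing D') (s same_direction : bool),
    bigon_kinds (kind a) (kind b) /\
    passages D = A ++ B ++ C /\
    passages D' =
      rename f A ++ [:: (a, s); (b, ~~ s)] ++ rename f B ++
      (if same_direction then [:: (a, ~~ s); (b, s)] else [:: (b, s); (a, ~~ s)])
      ++ rename f C.

(* Third move: arcs 1, 2, 3 (in the order in which the curve runs through them)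
   bound a triangle with vertices a = 1.2, b = 1.3, c = 2.3.  Here s12 is the
   name of arc 1 at a, and s13, s23 are the names of arc 1 at b and of arc 2 at
   c.  If the arcs are straight lines with directions d1, d2, d3, the lines 1 and
   2 pass through the origin, and line 3 has equation det(d3, x) = h, then
   - sij = false iff det(di, dj) > 0,
   - b - a is a positive multiple of d1 iff h * det(d3, d1) > 0,
   - c - a is a positive multiple of d2 iff h * det(d3, d2) > 0,
   - c - b is a positive multiple of d3 iff
       h * det(d1, d2) * det(d3, d2) * det(d1, d3) > 0.
   All eight sign patterns (s12, s13, s23) occur, and moving line 3 across the
   point a changes the sign of h only, whence [triangle_word] ([side] is the
   sign of h up to a convention). *)
Definition in_order (T : Type) (reversed : bool) (x y : T) : seq T :=
  if reversed then [:: y; x] else [:: x; y].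

Definition triangle_word (X : Type) (A B C E : seq (X * bool)) (a b c : X)
    (s12 s13 s23 side : bool) : seq (X * bool) :=
  A ++ in_order (side (+) s13) (a, s12) (b, s13) ++
  B ++ in_order (side (+) s23) (a, ~~ s12) (c, s23) ++
  C ++ in_order (side (+) s12 (+) s13 (+) s23) (b, ~~ s13) (c, ~~ s23) ++ E.

(* Three classical crossings: one arc is above, one in the middle, and one
   below, i.e. "over" is not cyclic on the arcs.  Otherwise at least two
   crossings are virtual: the arc on which both of them lie passes across the
   third crossing, classical (mixed move) or virtual. *)
Definition triangle_kinds (ka kb kc : crossing_kind) (s12 s13 s23 : bool) : bool :=
  match ka, kb, kc with
  | Classical u, Classical v, Classical w =>
      let over12 := u == s12 in
      let over13 := v == s13 in
      let over23 := w == s23 in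
      ~~ [&& over12, over23 & ~~ over13] && ~~ [&& ~~ over12, ~~ over23 & over13]
  | Virtual, Virtual, _ => true
  | Virtual, _, Virtual => true
  | _, Virtual, Virtual => true
  | _, _, _ => false
  end.

Definition reidemeister3 (D D' : curve_diagram) : Prop :=
  exists f : crossing D -> crossing D', carries f /\
  exists A B C E (a b c : crossing D) (s12 s13 s23 side : bool),
    triangle_kinds (kind a) (kind b) (kind c) s12 s13 s23 /\
    passages D = triangle_word A B C E a b c s12 s13 s23 side /\
    passages D' = rename f (triangle_word A B C E a b c s12 s13 s23 (~~ side)).

(* Both diagrams being planar, the new bigon, resp. the triangle, bounds a face,
   so that each move happens inside a disc not containing infinity. *)
Inductive long_move (K K' : long_diagram) : Prop :=
  | MoveIsotopy of planar_isotopy K K'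
  | MoveR1 of reidemeister1 K K'
  | MoveR2 of reidemeister2 K K'
  | MoveR3 of reidemeister3 K K'.

Definition long_equivalent : long_diagram -> long_diagram -> Prop :=
  clos_refl_sym_trans long_diagram long_move.

(* [opposite d] is the other half of the edge of the frame containing the
   half-edge d; [enum_branch v i], i = 1, 2, 3, 4, are the branches x_1, x_2, x_3,
   x_4 at the vertex v. *)
Record atom := Atom {
  vertex : finType;
  branch : finType;
  opposite : branch -> branch;
  enum_branch : vertex -> nat -> branch
}.

(* Cells are black (true) or white (false). *)
Definition angles (V : atom) (black : bool) (v : vertex V) :
    seq (branch V * branch V) :=
  let x := enum_branch v in
  if black then [:: (x 1, x 2); (x 3, x 4)] else [:: (x 2, x 3); (x 4, x 1)].

(* One step along the boundary of a cell of the given colour: follow an edge, or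
   turn through an angle of that colour. *)
Definition boundary_step (V : atom) (black : bool) : rel (branch V) :=
  fun d d' => (d' == opposite d) ||
    [exists v : vertex V, ((d, d') \in angles black v) ||
                          ((d', d) \in angles black v)].

(* The cell containing an angle: its colour and the half-edges met by its
   boundary cycle.  Each half-edge lies in one angle of each colour, so different
   cells of the same colour have disjoint sets of half-edges. *)
Definition cell_at (V : atom) (black : bool) (a : branch V * branch V) :
    bool * {set branch V} :=
  (black, [set d | connect (@boundary_step V black) a.1 d]).

Definition good_atom (V : atom) : Prop :=
  forall v : vertex V,
    uniq ([seq cell_at true a | a <- angles true v] ++
          [seq cell_at false a | a <- angles false v]).

Section AtomOfDiagram.
Variable L : knot_diagram.

Definition classical_crossing : finType :=
  {c : crossing L | is_classical (kind c)}.

Definition classical_passages : seq (classical_crossing * bool) :=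
  pmap (fun p => omap (fun c => (c, p.2)) (insub p.1)) (passages L).

Definition diagram_branch : finType := (classical_crossing * (bool * bool))%type.

(* The arcs of L between classical crossings: the outgoing branch of a classical
   passage is joined to the incoming branch of the cyclically next one. *)
Definition diagram_opposite (d : diagram_branch) : diagram_branch :=
  let: (c, (s, out)) := d in
  let p := if out then next classical_passages (c, s)
           else prev classical_passages (c, s) in
  (p.1, (p.2, ~~ out)).

Definition under_strand (k : crossing_kind) : bool :=
  if k is Classical s then ~~ s else false.

Definition diagram_enum (c : classical_crossing) (i : nat) : diagram_branch :=
  (c, iter i.-1 cw_branch (under_strand (kind (val c)), true)).

Definition atom_of : atom := Atom diagram_opposite diagram_enum.

End AtomOfDiagram.

Definition good (L : knot_diagram) : Prop := good_atom (atom_of L).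

(* Main.v *)
Require Import Defs.
From Stdlib Require Import FunctionalExtensionality.
From mathcomp Require Import all_boot all_order all_algebra realalg.
From mathcomp Require Import ring lra zify.

Set Implicit Arguments.
Unset Strict Implicit.
Unset Printing Implicit Defensive.

Import Order.TTheory GRing.Theory Num.Theory.

(** The crossings of a good diagram are counted by the growth of the Kauffman
    brackets of its cables.

    Call a crossing light if it is of a fixed kind [Classical u0] and heavy if
    it is of the other classical kind.  For both values of [u0], a good diagram
    has the least number of heavy crossings among the equivalent ones; the
    theorem is the sum of the two inequalities.

    The invariant.  Colour the edges of a diagram with N colours, N = q + 1/q.
    At a crossing, let P be the indicator of the colourings for which each
    incoming end agrees with the outgoing end of the other strand, and Q that of
    the colourings for which the two incoming ends agree and the two outgoing
    ends agree.  Light crossings have weight P - q^-1 Q, heavy ones P - q Q.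
    Up to normalisation, the sum over all colourings of the products of the
    weights is the bracket with loop value N.  It does not refer to the plane,
    so virtual crossings can be erased, and it is invariant under the second and
    the third move.  Replacing each strand by two parallel ones preserves these
    invariance properties ([two_cable_model]); r repetitions give the bracket of
    the 2^r-cable, whose colours are the 2^r-tuples.  The first move multiplies
    the sum by a kink, which is central and invertible ([kink_central], [kinkK]).
    Hence equivalent diagrams have the same sum once suitable light kinks are
    added to both ([long_equivalent_matrix]), which changes no number of heavy
    crossings.

    Upper bound.  P - q^-1 Q is an l2 contraction, and so is, read in another
    direction, 1/q times P - q Q.  So the entries of the cabled weights are at
    most 1 at light and q^(4^r) at heavy crossings, and a diagram with n
    crossings, h of them heavy, has a sum of at most N^(2^r * 2n) q^(4^r h)
    ([closed_sum_upper]).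

    Lower bound.  Expand the weights of all small crossings of the cable.  The
    state with P at light and Q at heavy crossings contributes q^(4^r h) times
    N to the number of its loops.  These loops are the boundaries of the white
    cells of the atom if [u0 = false], and of the black cells if [u0 = true].
    For a good diagram the two arcs of this state at any crossing lie on
    different loops, also after cabling ([good_adequate], [cable_adequate]).
    So the first change of a smoothing loses a loop, each further one gains at
    most one, and each costs a factor q^-1: all other states together are
    negligible for large N ([closed_sum_lower]).

    For r large, 4^r dominates the exponent 2^r * 2n of the error, and the two
    bounds for large N compare the numbers of heavy crossings
    ([heavy_number_le]). *)

Local Open Scope ring_scope.

(** * Finite sums *)

Section Sums.
Variable R : comNzRingType.

Lemma sum_deltal (C : finType) (a : C) (F : C -> R) :
  \sum_x (a == x)%:R * F x = F a.
Proof.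
rewrite (bigD1 a) //= eqxx mul1r big1 ?addr0 // => x xa.
by rewrite eq_sym (negbTE xa) mul0r.
Qed.

Lemma sum_deltal_sym (C : finType) (a : C) (F : C -> R) :
  \sum_x (x == a)%:R * F x = F a.
Proof. by rewrite -[RHS]sum_deltal; apply: eq_bigr => x _; rewrite eq_sym. Qed.

Lemma sum_deltar (C : finType) (a : C) (F : C -> R) :
  \sum_x F x * (x == a)%:R = F a.
Proof.
rewrite -[RHS]sum_deltal; apply: eq_bigr => x _.
by rewrite mulrC eq_sym.
Qed.

Lemma sum_pair (A B : finType) (F : A * B -> R) :
  \sum_x F x = \sum_a \sum_b F (a, b).
Proof. by rewrite pair_bigA; apply: eq_bigr; case. Qed.

Lemma exchange_big22 (X Y Z U : finType) (F : X -> Y -> Z -> U -> R) :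
  \sum_x \sum_y \sum_z \sum_u F x y z u = \sum_z \sum_u \sum_x \sum_y F x y z u.
Proof.
pose G p q := F p.1 p.2 q.1 q.2 : R.
transitivity (\sum_p \sum_q G p q); last rewrite exchange_big /=.
  by rewrite sum_pair; do 2!(apply: eq_bigr => ? _); rewrite sum_pair.
by rewrite sum_pair; do 2!(apply: eq_bigr => ? _); rewrite sum_pair.
Qed.

Lemma exchange_big23 (X Y Z U S : finType) (F : X -> Y -> Z -> U -> S -> R) :
  \sum_x \sum_y \sum_z \sum_u \sum_s F x y z u s =
  \sum_z \sum_u \sum_s \sum_x \sum_y F x y z u s.
Proof.
under eq_bigr => x _ do under eq_bigr => y _ do under eq_bigr => z _ do
  rewrite -(sum_pair (fun p => F x y z p.1 p.2)).
by rewrite exchange_big22; apply: eq_bigr => z _; rewrite sum_pair.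
Qed.

Lemma exchange_big33 (X Y Z U S T : finType)
    (F : X -> Y -> Z -> U -> S -> T -> R) :
  \sum_x \sum_y \sum_z \sum_u \sum_s \sum_t F x y z u s t =
  \sum_u \sum_s \sum_t \sum_x \sum_y \sum_z F x y z u s t.
Proof.
under eq_bigr => x _ do rewrite exchange_big23.
rewrite exchange_big; apply: eq_bigr => u _; rewrite exchange_big.
by apply: eq_bigr => s _; rewrite exchange_big.
Qed.

Lemma sum_mul2 (X Y : finType) (F : X -> R) (G : Y -> R) :
  (\sum_x F x) * (\sum_y G y) = \sum_x \sum_y F x * G y.
Proof. exact: big_distrlr. Qed.

Lemma sum_mul3 (X Y Z : finType) (F : X -> R) (G : Y -> R) (H : Z -> R) :
  (\sum_x F x) * (\sum_y G y) * (\sum_z H z) =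
  \sum_x \sum_y \sum_z F x * G y * H z.
Proof.
rewrite sum_mul2 mulr_suml; apply: eq_bigr => x _; rewrite mulr_suml.
by apply: eq_bigr => y _; rewrite mulr_sumr.
Qed.

End Sums.

(** * Crossing tensors, reversal of strands and the third move *)

Section Tensors.
Variable R : comNzRingType.

(** The weight of a crossing of two arcs, coloured by [A] and [B]: the arguments
    are the colours before and after the crossing on the first arc, then those
    on the second arc. *)
Definition tensor (A B : finType) := A -> A -> B -> B -> R.

Definition swap_arcs A B (T : tensor A B) : tensor B A :=
  fun c d a b => T a b c d.
(** Reading an arc against its direction; the operators below see only arcs that
    run in the same direction, and reversal reduces all other patterns to these. *)
Definition reverse1 A B (T : tensor A B) : tensor A B := fun a b => T b a.
Definition reverse2 A B (T : tensor A B) : tensor A B := fun a b c d => T a b d c.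

(** The first arc is doubled; [o] tells which of its two lanes the second arc meets
    first. *)
Definition fuse (o : bool) A B (T : tensor A B) : tensor (A * A)%type B :=
  fun a b c d =>
    \sum_e (if o then T a.2 b.2 c e * T a.1 b.1 e d
            else T a.1 b.1 c e * T a.2 b.2 e d).

(** Both arcs are doubled: the lanes of the second arc are met in the order [o1]
    by the first arc, those of the first arc in the order [o2] by the second. *)
Definition two_cable (o1 o2 : bool) A B (T : tensor A B) :
    tensor (A * A)%type (B * B)%type :=
  swap_arcs (fuse o1 (swap_arcs (fuse o2 T))).

(** The bigon of the second move, for two arcs running in the same direction; for
    opposite directions apply it to [reverse2] of both tensors. *)
Definition unitary A B (T S : tensor A B) : Prop := forall a b c d,
  \sum_x \sum_y T a x c y * S x b y d = (a == b)%:R * (c == d)%:R.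

(** Arc [a -> x -> b] passes two crossings; [first_in o] and [first_out o] are its
    ends at the first of them if [o = false], at the second if [o = true]. *)
Definition first_in (T : Type) (o : bool) (a x : T) := if o then x else a.
Definition first_out (T : Type) (o : bool) (b x : T) := if o then b else x.

(** Three arcs meet pairwise.  With [o1 = false] arc 1 meets arc 2 before arc 3, with
    [o2 = false] arc 2 meets arc 1 before arc 3, with [o3 = false] arc 3 meets
    arc 1 before arc 2.  The third move negates the three flags. *)
Definition triangle (o1 o2 o3 : bool) A B C
    (T12 : tensor A B) (T13 : tensor A C) (T23 : tensor B C)
    a1 b1 a2 b2 a3 b3 : R :=
  \sum_x \sum_y \sum_z
    T12 (first_in o1 a1 x) (first_out o1 b1 x)
        (first_in o2 a2 y) (first_out o2 b2 y) *
    T13 (first_in (~~ o1) a1 x) (first_out (~~ o1) b1 x)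
        (first_in o3 a3 z) (first_out o3 b3 z) *
    T23 (first_in (~~ o2) a2 y) (first_out (~~ o2) b2 y)
        (first_in (~~ o3) a3 z) (first_out (~~ o3) b3 z).

Definition yang_baxter o1 o2 o3 A B C
    (T12 : tensor A B) (T13 : tensor A C) (T23 : tensor B C) : Prop :=
  forall a1 b1 a2 b2 a3 b3,
    triangle o1 o2 o3 T12 T13 T23 a1 b1 a2 b2 a3 b3 =
    triangle (~~ o1) (~~ o2) (~~ o3) T12 T13 T23 a1 b1 a2 b2 a3 b3.

Lemma yang_baxter_reverse1 o1 o2 o3 A B C
    (T12 : tensor A B) (T13 : tensor A C) (T23 : tensor B C) :
  yang_baxter (~~ o1) o2 o3 (reverse1 T12) (reverse1 T13) T23 ->
  yang_baxter o1 o2 o3 T12 T13 T23.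
Proof. by move=> H a1 b1 a2 b2 a3 b3; case: o1 H => H; apply: H. Qed.

Lemma yang_baxter_reverse2 o1 o2 o3 A B C
    (T12 : tensor A B) (T13 : tensor A C) (T23 : tensor B C) :
  yang_baxter o1 (~~ o2) o3 (reverse2 T12) T13 (reverse1 T23) ->
  yang_baxter o1 o2 o3 T12 T13 T23.
Proof. by move=> H a1 b1 a2 b2 a3 b3; case: o2 H => H; apply: H. Qed.

Lemma yang_baxter_reverse3 o1 o2 o3 A B C
    (T12 : tensor A B) (T13 : tensor A C) (T23 : tensor B C) :
  yang_baxter o1 o2 (~~ o3) T12 (reverse2 T13) (reverse2 T23) ->
  yang_baxter o1 o2 o3 T12 T13 T23.
Proof. by move=> H a1 b1 a2 b2 a3 b3; case: o3 H => H; apply: H. Qed.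

Lemma yang_baxter_swap12 o1 o2 o3 A B C
    (T12 : tensor A B) (T13 : tensor A C) (T23 : tensor B C) :
  yang_baxter o2 o1 (~~ o3) (swap_arcs T12) T23 T13 ->
  yang_baxter o1 o2 o3 T12 T13 T23.
Proof.
have E p1 p2 p3 a1 b1 a2 b2 a3 b3 :
    triangle p1 p2 p3 T12 T13 T23 a1 b1 a2 b2 a3 b3 =
    triangle p2 p1 (~~ p3) (swap_arcs T12) T23 T13 a2 b2 a1 b1 a3 b3.
  rewrite /triangle exchange_big /=; apply: eq_bigr => y _.
  apply: eq_bigr => x _; apply: eq_bigr => z _.
  by rewrite negbK mulrAC.
by move=> H a1 b1 a2 b2 a3 b3; rewrite !E; apply: H.
Qed.

Lemma yang_baxter_swap23 o1 o2 o3 A B C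
    (T12 : tensor A B) (T13 : tensor A C) (T23 : tensor B C) :
  yang_baxter (~~ o1) o3 o2 T13 T12 (swap_arcs T23) ->
  yang_baxter o1 o2 o3 T12 T13 T23.
Proof.
have E p1 p2 p3 a1 b1 a2 b2 a3 b3 :
    triangle p1 p2 p3 T12 T13 T23 a1 b1 a2 b2 a3 b3 =
    triangle (~~ p1) p3 p2 T13 T12 (swap_arcs T23) a1 b1 a3 b3 a2 b2.
  rewrite /triangle; apply: eq_bigr => x _; rewrite exchange_big /=.
  apply: eq_bigr => z _; apply: eq_bigr => y _.
  by rewrite negbK [T13 _ _ _ _ * _]mulrC.
by move=> H a1 b1 a2 b2 a3 b3; rewrite !E; apply: H.
Qed.

(** A tensor as an operator on functions of the colours of two parallel arcs. *)
Definition act A B (T : tensor A B) (phi : A -> B -> R) : A -> B -> R :=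
  fun a c => \sum_x \sum_y T a x c y * phi x y.

Definition act12 A B C (T : tensor A B) (phi : A -> B -> C -> R) :
    A -> B -> C -> R :=
  fun a b c => act T (fun x y => phi x y c) a b.
Definition act13 A B C (T : tensor A C) (phi : A -> B -> C -> R) :
    A -> B -> C -> R :=
  fun a b c => act T (fun x z => phi x b z) a c.
Definition act23 A B C (T : tensor B C) (phi : A -> B -> C -> R) :
    A -> B -> C -> R :=
  fun a b c => act T (phi a) b c.

(** Written with operators, the fusion arguments below are mere rewriting: operators
    on disjoint pairs of arcs commute. *)
Definition braid_relation A B C
    (T12 : tensor A B) (T13 : tensor A C) (T23 : tensor B C) : Prop :=
  forall phi : A -> B -> C -> R,
    act12 T12 (act13 T13 (act23 T23 phi)) =
    act23 T23 (act13 T13 (act12 T12 phi)).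

Lemma act_braidE A B C (T12 : tensor A B) (T13 : tensor A C) (T23 : tensor B C)
    phi a1 a2 a3 :
  act12 T12 (act13 T13 (act23 T23 phi)) a1 a2 a3 =
  \sum_b1 \sum_b2 \sum_b3
    triangle false false false T12 T13 T23 a1 b1 a2 b2 a3 b3 * phi b1 b2 b3.
Proof.
rewrite /act12 /act13 /act23 /act /triangle /first_in /first_out /=.
under eq_bigr => x _ do under eq_bigr => y _ do
  (rewrite mulr_sumr; under eq_bigr => b1 _ do
     (rewrite !mulr_sumr; under eq_bigr => z _ do
        (rewrite !mulr_sumr; under eq_bigr => b2 _ do
           (rewrite !mulr_sumr; under eq_bigr => b3 _ do rewrite !mulrA)))).
under [RHS]eq_bigr => b1 _ do under eq_bigr => b2 _ do under eq_bigr => b3 _ do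
  (rewrite mulr_suml; under eq_bigr => x _ do
     (rewrite mulr_suml; under eq_bigr => y _ do rewrite mulr_suml)).
under [RHS]eq_bigr => b1 _ do under eq_bigr => b2 _ do
  (rewrite exchange_big /=; under eq_bigr => x _ do
     (rewrite exchange_big /=; under eq_bigr => y _ do rewrite exchange_big)).
under [RHS]eq_bigr => b1 _ do
  (rewrite exchange_big /=; under eq_bigr => x _ do
     (rewrite exchange_big /=; under eq_bigr => y _ do rewrite exchange_big)).
rewrite [RHS]exchange_big /=; apply: eq_bigr => x _.
rewrite [RHS]exchange_big /=; apply: eq_bigr => y _.
by [].
Qed.

Lemma act_braid_revE A B C (T12 : tensor A B) (T13 : tensor A C) (T23 : tensor B C)
    phi a1 a2 a3 :
  act23 T23 (act13 T13 (act12 T12 phi)) a1 a2 a3 =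
  \sum_b1 \sum_b2 \sum_b3
    triangle true true true T12 T13 T23 a1 b1 a2 b2 a3 b3 * phi b1 b2 b3.
Proof.
rewrite /act12 /act13 /act23 /act /triangle /first_in /first_out /=.
under eq_bigr => y _ do under eq_bigr => z _ do
  (rewrite mulr_sumr; under eq_bigr => x _ do
     (rewrite !mulr_sumr; under eq_bigr => b3 _ do
        (rewrite !mulr_sumr; under eq_bigr => b1 _ do
           (rewrite !mulr_sumr; under eq_bigr => b2 _ do rewrite !mulrA)))).
under [RHS]eq_bigr => b1 _ do under eq_bigr => b2 _ do under eq_bigr => b3 _ do
  (rewrite mulr_suml; under eq_bigr => x _ do
     (rewrite mulr_suml; under eq_bigr => y _ do rewrite mulr_suml)).
under eq_bigr => y _ do rewrite exchange_big /=.
rewrite exchange_big /=.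
under eq_bigr => x _ do under eq_bigr => y _ do under eq_bigr => z _ do
  rewrite exchange_big /=.
under eq_bigr => x _ do under eq_bigr => y _ do
  (under eq_bigr => z _ do
     (under eq_bigr => b1 _ do rewrite exchange_big /=)).
under [RHS]eq_bigr => b1 _ do under eq_bigr => b2 _ do
  (rewrite exchange_big /=; under eq_bigr => x _ do
     (rewrite exchange_big /=; under eq_bigr => y _ do rewrite exchange_big)).
under [RHS]eq_bigr => b1 _ do
  (rewrite exchange_big /=; under eq_bigr => x _ do
     (rewrite exchange_big /=; under eq_bigr => y _ do rewrite exchange_big)).
rewrite [RHS]exchange_big /=; apply: eq_bigr => x _.
rewrite [RHS]exchange_big /=; apply: eq_bigr => y _.
rewrite [RHS]exchange_big /=; apply: eq_bigr => z _.
apply: eq_bigr => b1 _; apply: eq_bigr => b2 _; apply: eq_bigr => b3 _.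
by congr (_ * _); rewrite mulrC [T23 _ _ _ _ * _]mulrC mulrA.
Qed.

Lemma braid_yang_baxter A B C
    (T12 : tensor A B) (T13 : tensor A C) (T23 : tensor B C) :
  yang_baxter false false false T12 T13 T23 <-> braid_relation T12 T13 T23.
Proof.
split=> H.
  move=> phi; apply: functional_extensionality => a1.
  apply: functional_extensionality => a2; apply: functional_extensionality => a3.
  rewrite act_braidE act_braid_revE.
  by do 3!(apply: eq_bigr => ? _); rewrite H.
move=> a1 b1 a2 b2 a3 b3.
pose phi x y z : R := (x == b1)%:R * ((y == b2)%:R * (z == b3)%:R).
have E (F : A -> B -> C -> R) :
    \sum_x \sum_y \sum_z F x y z * phi x y z = F b1 b2 b3.
  rewrite /phi.
  under eq_bigr => x _ do (under eq_bigr => y _ do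
    (under eq_bigr => z _ do rewrite !mulrA; rewrite sum_deltar); rewrite sum_deltar).
  by rewrite sum_deltar.
have := congr1 (fun f => f a1 a2 a3) (H phi).
by rewrite act_braidE act_braid_revE !E.
Qed.

End Tensors.

(** * Doubling a strand *)

Section Fusion.
Variable R : comNzRingType.

(** The operator of [T] on one lane of a doubled arc, the other lane being a
    spectator. *)
Definition lane1 A B (T : tensor R A B) (phi : A * A -> B -> R) :
    A * A -> B -> R :=
  fun a => act T (fun x => phi (x, a.2)) a.1.
Definition lane2 A B (T : tensor R A B) (phi : A * A -> B -> R) :
    A * A -> B -> R :=
  fun a => act T (fun x => phi (a.1, x)) a.2.

Lemma act_fuse o A B (T : tensor R A B) phi :
  act (fuse o T) phi =
  if o then lane2 T (lane1 T phi) else lane1 T (lane2 T phi).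
Proof.
apply: functional_extensionality => a; apply: functional_extensionality => c.
rewrite /act /fuse; case: o; rewrite /lane1 /lane2 /act /=.
- under [RHS]eq_bigr => x _ do under eq_bigr => y _ do
    (rewrite mulr_sumr; under eq_bigr => x' _ do
     (rewrite mulr_sumr; under eq_bigr => y' _ do rewrite mulrA)).
  under eq_bigr => x _ do under eq_bigr => y _ do rewrite mulr_suml.
  rewrite sum_pair exchange_big /=; apply: eq_bigr => x _.
  under eq_bigr => z _ do rewrite exchange_big /=.
  by rewrite exchange_big.
under [RHS]eq_bigr => x _ do under eq_bigr => y _ do
    (rewrite mulr_sumr; under eq_bigr => x' _ do
     (rewrite mulr_sumr; under eq_bigr => y' _ do rewrite mulrA)).
under eq_bigr => x _ do under eq_bigr => y _ do rewrite mulr_suml.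
rewrite sum_pair; apply: eq_bigr => x _.
under [LHS]eq_bigr => z _ do rewrite exchange_big /=.
by rewrite exchange_big.
Qed.

Lemma unitaryP A B (T S : tensor R A B) :
  unitary T S <-> forall phi, act T (act S phi) = phi.
Proof.
have E phi a c : act T (act S phi) a c =
    \sum_b \sum_d (\sum_x \sum_y T a x c y * S x b y d) * phi b d.
  rewrite /act /=.
  under [LHS]eq_bigr => x _ do under eq_bigr => y _ do
    (rewrite mulr_sumr; under eq_bigr => x' _ do
     (rewrite mulr_sumr; under eq_bigr => y' _ do rewrite mulrA)).
  under [RHS]eq_bigr => x _ do under eq_bigr => y _ do
    (rewrite mulr_suml; under eq_bigr => x' _ do rewrite mulr_suml).
  under [LHS]eq_bigr => x _ do rewrite exchange_big /=.
  rewrite exchange_big /=; apply: eq_bigr => b _.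
  under [LHS]eq_bigr => x _ do (rewrite exchange_big /=).
  rewrite [LHS]exchange_big /=; apply: eq_bigr => d _.
  by under [LHS]eq_bigr => x _ do under eq_bigr => y _ do [].
split=> H.
  move=> phi; apply: functional_extensionality => a.
  apply: functional_extensionality => c; rewrite E.
  under eq_bigr => b _ do under eq_bigr => d _ do rewrite H -mulrA.
  under eq_bigr => b _ do rewrite -mulr_sumr sum_deltal.
  by rewrite sum_deltal.
move=> a b c d.
have := congr1 (fun f => f a c) (H (fun x y => (x == b)%:R * (y == d)%:R)).
rewrite E /= => <-.
under [RHS]eq_bigr => x _ do (under eq_bigr => y _ do rewrite mulrA;
   rewrite sum_deltar).
by rewrite sum_deltar.
Qed.

Lemma lane1K A B (T S : tensor R A B) :
  unitary T S -> forall phi, lane1 T (lane1 S phi) = phi.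
Proof.
move=> /unitaryP H phi; apply: functional_extensionality => -[a a'].
by apply: functional_extensionality => c; rewrite /lane1 /= H.
Qed.

Lemma lane2K A B (T S : tensor R A B) :
  unitary T S -> forall phi, lane2 T (lane2 S phi) = phi.
Proof.
move=> /unitaryP H phi; apply: functional_extensionality => -[a a'].
by apply: functional_extensionality => c; rewrite /lane2 /= H.
Qed.

(** Two bigons nested in each other cancel from the inside outwards, whence the
    opposite orders of the lanes. *)
Lemma fuse_unitary o A B (T S : tensor R A B) :
  unitary T S -> unitary (fuse o T) (fuse (~~ o) S).
Proof.
move=> H; apply/unitaryP => phi; rewrite !act_fuse.
by case: o; rewrite /= ?lane1K ?lane2K // ?lane1K ?lane2K.
Qed.

Lemma swap_unitary A B (T S : tensor R A B) :
  unitary T S -> unitary (swap_arcs T) (swap_arcs S).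
Proof.
by move=> H a b c d; rewrite exchange_big /= H mulrC.
Qed.

Lemma two_cable_unitary o1 o2 A B (T S : tensor R A B) :
  unitary T S -> unitary (two_cable o1 o2 T) (two_cable (~~ o1) (~~ o2) S).
Proof.
by move=> H; apply/swap_unitary/fuse_unitary/swap_unitary/fuse_unitary.
Qed.

Lemma reverse1_fuse o A B (T : tensor R A B) :
  reverse1 (fuse o T) =
  fun a b c d => fuse o (reverse1 T) a b c d.
Proof. by []. Qed.

Lemma reverse2_fuse o A B (T : tensor R A B) :
  reverse2 (fuse o T) = fuse (~~ o) (reverse2 T).
Proof.
do 4!(apply: functional_extensionality => ?).
by rewrite /reverse2 /fuse; apply: eq_bigr => e _; case: o; rewrite mulrC.
Qed.

Lemma reverse2_two_cable o1 o2 A B (T : tensor R A B) :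
  reverse2 (two_cable o1 o2 T) = two_cable o1 (~~ o2) (reverse2 T).
Proof.
rewrite /two_cable -reverse2_fuse.
by do 4!(apply: functional_extensionality => ?).
Qed.

(** The four small crossings are summed in a different order, but the diagram is the
    same. *)
Lemma two_cable_swap o1 o2 A B (T : tensor R A B) :
  swap_arcs (two_cable o1 o2 T) = two_cable o2 o1 (swap_arcs T).
Proof.
do 4!(apply: functional_extensionality => ?).
rewrite /two_cable /swap_arcs /fuse !sum_pair.
have distr (X Y : finType) (F : X -> R) (G : Y -> R) :
  (\sum_x F x) * (\sum_y G y) = \sum_x \sum_y F x * G y by exact: big_distrlr.
case: o1; case: o2 => /=;
under [LHS]eq_bigr => e1 _ do under eq_bigr => e2 _ do rewrite distr;
under [RHS]eq_bigr => e1 _ do under eq_bigr => e2 _ do rewrite distr;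
rewrite exchange_big22.
- rewrite exchange_big /=; do 2!(apply: eq_bigr => ? _).
  by rewrite exchange_big /=; do 2!(apply: eq_bigr => ? _); rewrite mulrACA.
- rewrite exchange_big /=; do 4!(apply: eq_bigr => ? _).
  by rewrite mulrACA.
- do 2!(apply: eq_bigr => ? _).
  by rewrite exchange_big /=; do 2!(apply: eq_bigr => ? _); rewrite mulrACA.
by do 4!(apply: eq_bigr => ? _); rewrite mulrACA.
Qed.

Section Braid.
Variables (A B C : finType).
Variables (T12 : tensor R A B) (T13 : tensor R A C) (T23 : tensor R B C).

Let act12_1 (phi : A * A -> B -> C -> R) : A * A -> B -> C -> R :=
  fun a b c => act T12 (fun x y => phi (x, a.2) y c) a.1 b.
Let act12_2 (phi : A * A -> B -> C -> R) : A * A -> B -> C -> R :=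
  fun a b c => act T12 (fun x y => phi (a.1, x) y c) a.2 b.
Let act13_1 (phi : A * A -> B -> C -> R) : A * A -> B -> C -> R :=
  fun a b c => act T13 (fun x z => phi (x, a.2) b z) a.1 c.
Let act13_2 (phi : A * A -> B -> C -> R) : A * A -> B -> C -> R :=
  fun a b c => act T13 (fun x z => phi (a.1, x) b z) a.2 c.
Let act23' (phi : A * A -> B -> C -> R) : A * A -> B -> C -> R := act23 T23 phi.

Let fuse12 o phi : act12 (fuse o T12) phi =
  if o then act12_2 (act12_1 phi) else act12_1 (act12_2 phi).
Proof.
apply: functional_extensionality => a; apply: functional_extensionality => b.
apply: functional_extensionality => c.
by rewrite /act12 act_fuse; case: o.
Qed.

Let fuse13 o phi : act13 (fuse o T13) phi =
  if o then act13_2 (act13_1 phi) else act13_1 (act13_2 phi).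
Proof.
apply: functional_extensionality => a; apply: functional_extensionality => b.
apply: functional_extensionality => c.
by rewrite /act13 act_fuse; case: o.
Qed.

Let sum4C (X Y Z U : finType) (f : X -> Y -> R) (g : Z -> U -> R) h :
  \sum_x \sum_y f x y * (\sum_z \sum_u g z u * h x y z u) =
  \sum_z \sum_u g z u * (\sum_x \sum_y f x y * h x y z u).
Proof.
under [RHS]eq_bigr => x _ do under eq_bigr => y _ do
  (rewrite mulr_sumr; under eq_bigr => z _ do
     (rewrite mulr_sumr; under eq_bigr => u _ do rewrite mulrCA)).
rewrite exchange_big22; do 2!(apply: eq_bigr => ? _).
by rewrite mulr_sumr; apply: eq_bigr => ? _; rewrite mulr_sumr.
Qed.

Let act12_2_act13_1 phi : act12_2 (act13_1 phi) = act13_1 (act12_2 phi).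
Proof.
apply: functional_extensionality => a; apply: functional_extensionality => b.
apply: functional_extensionality => c.
exact: (sum4C (fun x y => T12 a.2 x b y) (fun x z => T13 a.1 x c z)
  (fun x y x' z => phi (x', x) y z)).
Qed.

Let act12_1_act13_2 phi : act12_1 (act13_2 phi) = act13_2 (act12_1 phi).
Proof.
apply: functional_extensionality => a; apply: functional_extensionality => b.
apply: functional_extensionality => c.
exact: (sum4C (fun x y => T12 a.1 x b y) (fun x z => T13 a.2 x c z)
  (fun x y x' z => phi (x, x') y z)).
Qed.

Hypothesis braid : braid_relation T12 T13 T23.

Let braid_1 phi :
  act12_1 (act13_1 (act23' phi)) = act23' (act13_1 (act12_1 phi)).
Proof.
apply: functional_extensionality => -[a a'].
exact: (congr1 (fun f => f a) (braid (fun x y z => phi (x, a') y z))).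
Qed.

Let braid_2 phi :
  act12_2 (act13_2 (act23' phi)) = act23' (act13_2 (act12_2 phi)).
Proof.
apply: functional_extensionality => -[a a'].
exact: (congr1 (fun f => f a') (braid (fun x y z => phi (a, x) y z))).
Qed.

(** The third arc is moved across the two lanes one after the other; in between, the
    operators of different lanes on different arcs are interchanged. *)
Lemma fuse_braid o : braid_relation (fuse o T12) (fuse o T13) T23.
Proof.
move=> phi; rewrite !fuse12 !fuse13 -/(act23' _) -/(act23' phi).
case: o.
  by rewrite act12_1_act13_2 braid_1 braid_2 act12_2_act13_1.
by rewrite act12_2_act13_1 braid_2 braid_1 act12_1_act13_2.
Qed.

End Braid.

End Fusion.

(** * Vertex models and their two-cables *)

Section Cabling.
Variable R : comNzRingType.

(** The condition on the flags says that arcs 2 and 3 meet the two lanes of arc 1 in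
    the geometrically consistent order.  Reversing arcs reduces all cases to
    [fuse_braid]. *)
Lemma fuse_yang_baxter o1 o2 o3 p2 p3 A B C
    (T12 : tensor R A B) (T13 : tensor R A C) (T23 : tensor R B C) :
  p2 (+) p3 = o2 (+) o3 -> yang_baxter o1 o2 o3 T12 T13 T23 ->
  yang_baxter o1 o2 o3 (fuse p2 T12) (fuse p3 T13) T23.
Proof.
wlog -> : o1 T12 T13 / o1 = false.
  move=> W Hp H; case: o1 H => H; last exact: W.
  apply: yang_baxter_reverse1; rewrite !reverse1_fuse; apply: W => //.
  exact: (yang_baxter_reverse1 (o1 := false)).
wlog -> : o2 p2 T12 T23 / o2 = false.
  move=> W Hp H; case: o2 Hp H => Hp H; last exact: W.
  apply: yang_baxter_reverse2; rewrite reverse2_fuse; apply: W => //.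
    by case: p2 p3 o3 Hp {H} => [] [] [].
  exact: (yang_baxter_reverse2 (o2 := false)).
wlog -> : o3 p3 T13 T23 / o3 = false.
  move=> W Hp H; case: o3 Hp H => Hp H; last exact: W.
  apply: yang_baxter_reverse3; rewrite reverse2_fuse; apply: W => //.
    by case: p2 p3 Hp {H} => [] [].
  exact: (yang_baxter_reverse3 (o3 := false)).
move=> Hp /braid_yang_baxter H; apply/braid_yang_baxter.
have -> : p3 = p2 by case: p2 p3 Hp => [] [].
exact: fuse_braid.
Qed.

(** Each arc in turn is made the first one by relabelling, and then doubled. *)
Lemma two_cable_yang_baxter o1 o2 o3 p12 q12 p13 q13 p23 q23 A B C
    (T12 : tensor R A B) (T13 : tensor R A C) (T23 : tensor R B C) :
  q12 (+) q13 = o2 (+) o3 -> p12 (+) q23 = ~~ (o1 (+) o3) ->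
  p13 (+) p23 = o1 (+) o2 ->
  yang_baxter o1 o2 o3 T12 T13 T23 ->
  yang_baxter o1 o2 o3 (two_cable p12 q12 T12) (two_cable p13 q13 T13)
    (two_cable p23 q23 T23).
Proof.
move=> H1 H2 H3 H.
have {}H := fuse_yang_baxter H1 H.
have {}H : yang_baxter o2 o1 (~~ o3) (swap_arcs (fuse q12 T12)) T23 (fuse q13 T13).
  by apply: yang_baxter_swap12; rewrite negbK.
have {}H := @fuse_yang_baxter _ _ _ p12 q23 _ _ _ _ _ _ _ H.
rewrite addbN in H; have {}H := H H2.
have {}H : yang_baxter o3 (~~ o1) (~~ o2) (swap_arcs (fuse q13 T13))
    (swap_arcs (fuse q23 T23)) (two_cable p12 q12 T12).
  apply: yang_baxter_swap12; rewrite negbK.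
  apply: yang_baxter_swap23; rewrite negbK.
  by apply: yang_baxter_swap12.
have {}H := @fuse_yang_baxter _ _ _ p13 p23 _ _ _ _ _ _ _ H.
rewrite addbN addNb negbK in H; have {}H := H H3.
apply: yang_baxter_swap23; apply: yang_baxter_swap12.
exact: H.
Qed.

(** The weight of a crossing seen from the arc that is its strand [s]. *)
Definition oriented A (T : tensor R A A) (s : bool) :=
  if s then swap_arcs T else T.
Definition reverse_if (r : bool) A B (T : tensor R A B) :=
  if r then reverse2 T else T.

(** A colour set with crossing weights whose state sum is invariant under the second
    and the third move, for all directions of the arcs.  The first move is
    excluded, since it fails for cables.  The flags of [weight_R3] are those of
    [triangle_word].  [color0] is an arbitrary colour. *)
Record vertex_model := VertexModel {
  color : finType;
  color0 : color;
  weight : bool -> tensor R color color;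
  weight_R2 : forall u s r,
    unitary (reverse_if r (oriented (weight u) s))
            (reverse_if r (oriented (weight (~~ u)) (~~ s)));
  weight_R3 : forall u v w s12 s13 s23 side,
    triangle_kinds (Classical u) (Classical v) (Classical w) s12 s13 s23 ->
    yang_baxter (side (+) s13) (side (+) s23) (side (+) s12 (+) s13 (+) s23)
      (oriented (weight u) s12) (oriented (weight v) s13)
      (oriented (weight w) s23)
}.

Arguments color0 : clear implicits.
Arguments weight : clear implicits.
Arguments weight_R2 : clear implicits.
Arguments weight_R3 : clear implicits.

(** Lanes are numbered from left to right: strand [false] meets the lanes of strand
    [true] in this order, strand [true] meets those of strand [false] in the
    opposite order. *)
Lemma oriented_two_cable A (T : tensor R A A) s :
  oriented (two_cable false true T) s = two_cable s (~~ s) (oriented T s).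
Proof. by case: s => //; exact: two_cable_swap. Qed.

Section TwoCableModel.
Variable V : vertex_model.
Let W u := two_cable false true (weight V u).

Lemma two_cable_R2 u s r :
  unitary (reverse_if r (oriented (W u) s))
          (reverse_if r (oriented (W (~~ u)) (~~ s))).
Proof.
rewrite !oriented_two_cable; case: r (weight_R2 V u s r) => /= H.
  by rewrite !reverse2_two_cable; exact: two_cable_unitary.
exact: two_cable_unitary.
Qed.

Lemma two_cable_R3 u v w s12 s13 s23 side :
  triangle_kinds (Classical u) (Classical v) (Classical w) s12 s13 s23 ->
  yang_baxter (side (+) s13) (side (+) s23) (side (+) s12 (+) s13 (+) s23)
    (oriented (W u) s12) (oriented (W v) s13) (oriented (W w) s23).
Proof.
move=> /(weight_R3 V _ _ _ _ _ _ side) H; rewrite !oriented_two_cable.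
by apply: two_cable_yang_baxter H; case: s12; case: s13; case: s23; case: side.
Qed.

Definition two_cable_model :=
  VertexModel (color0 V, color0 V) two_cable_R2 two_cable_R3.

End TwoCableModel.

Section Base.
Variables (C : finType) (c0 : C) (x : bool -> R).
Hypothesis xN : forall u, x u * x (~~ u) = 1.
Hypothesis loop : forall u, x u + x (~~ u) = #|C|%:R.

(** P - t Q in the notation of the introduction. *)
Definition crossing_tensor (t : R) : tensor R C C := fun a b c d =>
  (a == d)%:R * (b == c)%:R - t * ((a == c)%:R * (b == d)%:R).

Lemma swap_crossing t : swap_arcs (crossing_tensor t) = crossing_tensor t.
Proof.
apply: functional_extensionality => a; apply: functional_extensionality => b.
apply: functional_extensionality => c; apply: functional_extensionality => d.
rewrite /swap_arcs /crossing_tensor (eq_sym a d) (eq_sym a c) (eq_sym b c).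
by rewrite (eq_sym b d) [X in X - _]mulrC.
Qed.

Lemma oriented_crossing t s : oriented (crossing_tensor t) s = crossing_tensor t.
Proof. by case: s => //; exact: swap_crossing. Qed.

(** Reversing a strand exchanges P and Q, and so the two kinds up to a scalar.  The
    scalars cancel in the second and the third move. *)
Lemma reverse1_crossing u : reverse1 (crossing_tensor (x u)) =
  fun a b c d => - x u * crossing_tensor (x (~~ u)) a b c d.
Proof.
apply: functional_extensionality => a; apply: functional_extensionality => b.
apply: functional_extensionality => c; apply: functional_extensionality => d.
rewrite /reverse1 /crossing_tensor -[X in X - _]mul1r -(xN u); ring.
Qed.

Lemma reverse2_crossing u : reverse2 (crossing_tensor (x u)) =
  fun a b c d => - x u * crossing_tensor (x (~~ u)) a b c d.
Proof.
apply: functional_extensionality => a; apply: functional_extensionality => b.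
apply: functional_extensionality => c; apply: functional_extensionality => d.
rewrite /reverse2 /crossing_tensor -[X in X - _]mul1r -(xN u); ring.
Qed.

Lemma act_crossing t phi :
  act (crossing_tensor t) phi =
  fun a b => phi b a - t * ((a == b)%:R * \sum_y phi y y).
Proof.
apply: functional_extensionality => a; apply: functional_extensionality => c.
rewrite /act /crossing_tensor.
under eq_bigr => x' _ do under eq_bigr => y _ do rewrite mulrBl.
under eq_bigr => x' _ do rewrite sumrB.
rewrite sumrB; congr (_ - _).
  under eq_bigr => x' _ do
    (under eq_bigr => y _ do rewrite -mulrA; rewrite sum_deltal eq_sym).
  by rewrite sum_deltal.
rewrite !mulr_sumr; apply: eq_bigr => y _.
rewrite -[in RHS](sum_deltal y (phi y)) !mulr_sumr; apply: eq_bigr => z _.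
ring.
Qed.

Let sum_diag (S : R) : \sum_(y : C) ((y == y)%:R * S) = #|C|%:R * S.
Proof.
under eq_bigr => y _ do rewrite eqxx mul1r.
by rewrite sumr_const mulr_natl.
Qed.

(** The operators P and Q satisfy P P = 1, P Q = Q P = Q and Q Q = N Q. *)
Lemma crossing_unitary u :
  unitary (crossing_tensor (x u)) (crossing_tensor (x (~~ u))).
Proof.
apply/unitaryP => phi; rewrite !act_crossing.
apply: functional_extensionality => a; apply: functional_extensionality => b.
rewrite sumrB -mulr_sumr sum_diag -(loop u) (eq_sym b a).
move: (\sum_y _) (a == b)%:R => S e.
have -> : x u * (e * (S - x (~~ u) * ((x u + x (~~ u)) * S))) =
  e * S * (x u - x u * (x u * x (~~ u)) - (x u * x (~~ u)) * x (~~ u)) by ring.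
rewrite xN; ring.
Qed.

Lemma scale_unitary A B (T S : tensor R A B) k l : k * l = 1 -> unitary T S ->
  unitary (fun a b c d => k * T a b c d) (fun a b c d => l * S a b c d).
Proof.
move=> kl H a b c d; rewrite -H; apply: eq_bigr => e _; apply: eq_bigr => f _.
by rewrite mulrACA kl mul1r.
Qed.

Lemma scale_yang_baxter o1 o2 o3 A1 A2 A3 (T12 : tensor R A1 A2)
    (T13 : tensor R A1 A3) (T23 : tensor R A2 A3) k12 k13 k23 :
  yang_baxter o1 o2 o3 T12 T13 T23 ->
  yang_baxter o1 o2 o3 (fun a b c d => k12 * T12 a b c d)
    (fun a b c d => k13 * T13 a b c d) (fun a b c d => k23 * T23 a b c d).
Proof.
have E p1 p2 p3 a1 b1 a2 b2 a3 b3 : triangle p1 p2 p3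
    (fun a b c d => k12 * T12 a b c d) (fun a b c d => k13 * T13 a b c d)
    (fun a b c d => k23 * T23 a b c d) a1 b1 a2 b2 a3 b3 =
    k12 * k13 * k23 * triangle p1 p2 p3 T12 T13 T23 a1 b1 a2 b2 a3 b3.
  rewrite /triangle mulr_sumr; apply: eq_bigr => e _.
  rewrite mulr_sumr; apply: eq_bigr => f _.
  by rewrite mulr_sumr; apply: eq_bigr => g _; ring.
by move=> H a1 b1 a2 b2 a3 b3; rewrite !E H.
Qed.

Let act12E t (phi : C -> C -> C -> R) : act12 (crossing_tensor t) phi =
  fun a b c => phi b a c - t * ((a == b)%:R * \sum_y phi y y c).
Proof.
do 3!(apply: functional_extensionality => ?).
by rewrite /act12 act_crossing.
Qed.
Let act13E t (phi : C -> C -> C -> R) : act13 (crossing_tensor t) phi =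
  fun a b c => phi c b a - t * ((a == c)%:R * \sum_y phi y b y).
Proof.
do 3!(apply: functional_extensionality => ?).
by rewrite /act13 act_crossing.
Qed.
Let act23E t (phi : C -> C -> C -> R) : act23 (crossing_tensor t) phi =
  fun a b c => phi a c b - t * ((b == c)%:R * \sum_y phi a y y).
Proof.
do 3!(apply: functional_extensionality => ?).
by rewrite /act23 act_crossing.
Qed.

(** After expansion, the two sides differ by a multiple of a single scalar, which
    vanishes because x^2 - N x + 1 = 0 for both
    roots. *)
Lemma crossing_braid u v w : (v == u) || (v == w) ->
  braid_relation (crossing_tensor (x u)) (crossing_tensor (x v))
    (crossing_tensor (x w)).
Proof.
move=> uvw phi.
apply: functional_extensionality => a; apply: functional_extensionality => b.
apply: functional_extensionality => c.
rewrite !(act12E, act13E, act23E).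
rewrite !(sumrB, =^~ mulr_sumr, sum_deltal, sum_deltal_sym, sum_diag).
(* The coefficient by which the two sides differ. *)
have {}uvw : x v - x u - x w + x u * x w * #|C|%:R - x u * x w * x v = 0.
  case/orP: uvw => /eqP ->.
    rewrite -(loop u).
    have -> : x u - x u - x w + x u * x w * (x u + x (~~ u)) - x u * x w * x u
      = x w * (x u * x (~~ u) - 1) by ring.
    by rewrite xN subrr mulr0.
  rewrite -(loop w).
  have -> : x w - x u - x w + x u * x w * (x w + x (~~ w)) - x u * x w * x w
      = x u * (x w * x (~~ w) - 1) by ring.
  by rewrite xN subrr mulr0.
apply/eqP; rewrite -subr_eq0; apply/eqP.
set U := \sum_y phi c y y; set V := \sum_y phi y y a.
transitivity ((x v - x u - x w + x u * x w * #|C|%:R - x u * x w * x v) *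
  ((a == b)%:R * U - (b == c)%:R * V)); last by rewrite uvw mul0r.
ring.
Qed.

(** The condition on the kinds is the one of [crossing_braid] after reversal of the
    arcs with flag [true]. *)
Lemma crossing_yang_baxter o1 o2 o3 u v w :
  (v (+) o1 (+) o3 == u (+) o1 (+) o2) || (v (+) o1 (+) o3 == w (+) o2 (+) o3) ->
  yang_baxter o1 o2 o3 (crossing_tensor (x u)) (crossing_tensor (x v))
    (crossing_tensor (x w)).
Proof.
have T1 y : crossing_tensor y = fun a b c d => 1 * crossing_tensor y a b c d.
  by do 4!(apply: functional_extensionality => ?); rewrite mul1r.
wlog -> : o1 u v / o1 = false.
  move=> W Hp; case: o1 Hp => Hp; last exact: W.
  apply: yang_baxter_reverse1; rewrite !reverse1_crossing [crossing_tensor (x w)]T1.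
  apply: scale_yang_baxter; apply: W => //.
  by case: u v w o2 o3 Hp => [] [] [] [] [].
wlog -> : o2 u w / o2 = false.
  move=> W Hp; case: o2 Hp => Hp; last exact: W.
  apply: yang_baxter_reverse2; rewrite reverse1_crossing reverse2_crossing.
  rewrite [crossing_tensor (x v)]T1; apply: scale_yang_baxter; apply: W => //.
  by case: u v w o3 Hp => [] [] [] [].
wlog -> : o3 v w / o3 = false.
  move=> W Hp; case: o3 Hp => Hp; last exact: W.
  apply: yang_baxter_reverse3; rewrite !reverse2_crossing.
  rewrite [crossing_tensor (x u)]T1; apply: scale_yang_baxter; apply: W => //.
  by case: u v w Hp => [] [] [].
rewrite !addbF => uvw; apply/braid_yang_baxter; exact: crossing_braid.
Qed.

Let W u := crossing_tensor (x u).

Lemma crossing_R2 u s r :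
  unitary (reverse_if r (oriented (W u) s))
          (reverse_if r (oriented (W (~~ u)) (~~ s))).
Proof.
rewrite !oriented_crossing; case: r => /=; last exact: crossing_unitary.
rewrite !reverse2_crossing; apply: scale_unitary.
  by rewrite mulrNN xN.
exact: crossing_unitary.
Qed.

Lemma crossing_R3 u v w s12 s13 s23 side :
  triangle_kinds (Classical u) (Classical v) (Classical w) s12 s13 s23 ->
  yang_baxter (side (+) s13) (side (+) s23) (side (+) s12 (+) s13 (+) s23)
    (oriented (W u) s12) (oriented (W v) s13) (oriented (W w) s23).
Proof.
move=> H; rewrite !oriented_crossing; apply: crossing_yang_baxter.
by case: u v w s12 s13 s23 side H => [] [] [] [] [] [] [].
Qed.

Definition crossing_model := VertexModel c0 crossing_R2 crossing_R3.

End Base.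
End Cabling.

Arguments color {R} _.
Arguments color0 {R} _.
Arguments weight {R} _ _.
Arguments weight_R2 {R} _ _ _ _.
Arguments weight_R3 {R} _ _ _ _ _ _ _ _ _.

(** * Kinks *)

Section Kernels.
Variables (R : comNzRingType) (C : finType).

Definition kernel := C -> C -> R.
Definition kid : kernel := fun a b => (a == b)%:R.
Definition kmul (f g : kernel) : kernel := fun a b => \sum_x f a x * g x b.

Lemma kmul1k f : kmul kid f = f.
Proof.
do 2!(apply: functional_extensionality => ?); exact: sum_deltal.
Qed.

Lemma kmulk1 f : kmul f kid = f.
Proof.
do 2!(apply: functional_extensionality => ?); exact: sum_deltar.
Qed.

Lemma kmulA f g h : kmul f (kmul g h) = kmul (kmul f g) h.
Proof.
apply: functional_extensionality => a; apply: functional_extensionality => b.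
rewrite /kmul.
under eq_bigr => x _ do rewrite mulr_sumr.
under [RHS]eq_bigr => x _ do rewrite mulr_suml.
rewrite exchange_big; apply: eq_bigr => y _; apply: eq_bigr => x _.
by rewrite mulrA.
Qed.

End Kernels.

Section Kinks.
Variables (R : comNzRingType) (V : vertex_model R).

Let C := color V.
Let X u s := oriented (weight V u) s.

(** The partial closure of a crossing: strand [s], then the loop, then strand [~~ s]. *)
Definition kink u s : kernel R C := fun a b => \sum_x X u s a x x b.

(** A strand is slid over or under a kink.  A second move makes it cross the loop of
    the kink, a third move takes it across the crossing of the kink, and a second
    move on the other side frees it again.  Whether it runs parallel or
    antiparallel to the kinked strand at the bigons depends on [s (+) s']. *)
Lemma kink_central u s v s' a b c d :
  \sum_x kink u s a x * X v s' x b c d = \sum_x X v s' a x c d * kink u s x b.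
Proof.
have yb : yang_baxter false false (s (+) s') (X u s) (X v s') (X v s').
  have := weight_R3 V u v v s s' s' s'; rewrite addbb.
  rewrite [s' (+) s]addbC addbK; apply.
  by rewrite /=; case: u v s s' => [] [] [] [].
(* [kl] and [kr] cut the strands at the place where a bigon is to be inserted,
   resp. has been removed. *)
have kl (F : C -> C -> R) (e0 : C) : \sum_x kink u s a x * F x e0 =
    \sum_p' \sum_p \sum_x \sum_e (X u s a p p' x * F x e) *
      ((p == p')%:R * (e == e0)%:R).
  rewrite exchange_big /=.
  under [LHS]eq_bigr => x _ do rewrite mulr_suml.
  rewrite exchange_big /=; apply: eq_bigr => p _.
  rewrite exchange_big /=; apply: eq_bigr => x _.
  under [RHS]eq_bigr => p' _ do
    (under eq_bigr => e _ do rewrite mulrA; rewrite sum_deltar mulrC).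
  by rewrite sum_deltal.
have kr (F : C -> C -> R) (e0 : C) : \sum_x F x e0 * kink u s x b =
    \sum_r \sum_x \sum_y \sum_e (X u s x r y b * F x e) *
      ((r == y)%:R * (e0 == e)%:R).
  rewrite exchange_big /=; apply: eq_bigr => x _.
  rewrite mulr_sumr; apply: eq_bigr => r _.
  under [RHS]eq_bigr => p' _ do
    (under eq_bigr => e _ do rewrite mulrA [(e0 == e)]eq_sym;
     rewrite sum_deltar mulrC).
  by rewrite sum_deltal mulrC.
case: (boolP (s (+) s')) yb => [_|_] yb.
  have R2 p p' e f : \sum_r \sum_e' X v s' p r e e' * X (~~ v) (~~ s') r p' e' f
      = (p == p')%:R * (e == f)%:R := weight_R2 V v s' false p p' e f.
  have R2' r y e f : \sum_p \sum_e' X (~~ v) (~~ s') r p e' f * X v s' p y e e'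
      = (r == y)%:R * (f == e)%:R.
    by have := weight_R2 V (~~ v) (~~ s') true r y f e; rewrite !negbK.
  rewrite (kl (fun x e => X v s' x b c e)) (kr (fun x e => X v s' a x c e)).
  transitivity (\sum_p' \sum_r \sum_e
    triangle false false true (X u s) (X v s') (X v s') a r p' b c e *
    X (~~ v) (~~ s') r p' e d).
    apply: eq_bigr => p' _.
    rewrite /triangle /first_in /first_out /=.
    under [RHS]eq_bigr => r _ do under eq_bigr => e _ do
      (rewrite mulr_suml; under eq_bigr => p _ do
        (rewrite mulr_suml; under eq_bigr => x _ do rewrite mulr_suml)).
    rewrite exchange_big23; do 3!(apply: eq_bigr => ? _).
    rewrite -R2 mulr_sumr; apply: eq_bigr => r _.
    rewrite mulr_sumr; apply: eq_bigr => e _; ring.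
  rewrite exchange_big /=; apply: eq_bigr => r _.
  under [LHS]eq_bigr => r' _ do under eq_bigr => e _ do
    (rewrite yb /triangle /first_in /first_out /= mulr_suml;
     under eq_bigr => p _ do
        (rewrite mulr_suml; under eq_bigr => x _ do rewrite mulr_suml)).
  rewrite exchange_big23; do 3!(apply: eq_bigr => ? _).
  rewrite -R2' mulr_sumr; apply: eq_bigr => x _.
  rewrite mulr_sumr; apply: eq_bigr => e _; ring.
have R2 p p' e f : \sum_r \sum_e' X v s' p r e' e * X (~~ v) (~~ s') r p' f e'
    = (p == p')%:R * (e == f)%:R := weight_R2 V v s' true p p' e f.
have R2' r y e f : \sum_p \sum_e' X (~~ v) (~~ s') r p f e' * X v s' p y e' e
    = (r == y)%:R * (f == e)%:R.
  by have := weight_R2 V (~~ v) (~~ s') false r y f e; rewrite !negbK.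
rewrite (kl (fun x e => X v s' x b e d)) (kr (fun x e => X v s' a x e d)).
transitivity (\sum_p' \sum_r \sum_e
  triangle false false false (X u s) (X v s') (X v s') a r p' b e d *
  X (~~ v) (~~ s') r p' c e).
  apply: eq_bigr => p' _.
  rewrite /triangle /first_in /first_out /=.
  under [RHS]eq_bigr => r _ do under eq_bigr => e _ do
    (rewrite mulr_suml; under eq_bigr => p _ do
      (rewrite mulr_suml; under eq_bigr => x _ do rewrite mulr_suml)).
  rewrite exchange_big23; do 3!(apply: eq_bigr => ? _).
  rewrite -R2 mulr_sumr; apply: eq_bigr => r _.
  rewrite mulr_sumr; apply: eq_bigr => e _; ring.
rewrite exchange_big /=; apply: eq_bigr => r _.
under [LHS]eq_bigr => r' _ do under eq_bigr => e _ do
  (rewrite yb /triangle /first_in /first_out /= mulr_suml;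
   under eq_bigr => p _ do
      (rewrite mulr_suml; under eq_bigr => x _ do rewrite mulr_suml)).
rewrite exchange_big23; do 3!(apply: eq_bigr => ? _).
rewrite -R2' mulr_sumr; apply: eq_bigr => x _.
rewrite mulr_sumr; apply: eq_bigr => e _; ring.
Qed.

(** Two nested kinks of opposite kinds form a bigon of antiparallel arcs; the inner one
    can be taken out by [kink_central]. *)
Lemma kinkK u s : kmul (kink u s) (kink (~~ u) (~~ s)) = @kid R C.
Proof.
apply: functional_extensionality => a; apply: functional_extensionality => b.
have R2 z : \sum_x \sum_y X (~~ u) (~~ s) a x y b * X u s x z z y =
    (a == z)%:R * (b == z)%:R.
  by have := weight_R2 V (~~ u) (~~ s) true a z b z; rewrite !negbK.
transitivity (\sum_z (a == z)%:R * (b == z)%:R : R); last first.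
  by rewrite sum_deltal eq_sym.
transitivity (\sum_z \sum_x \sum_y X (~~ u) (~~ s) a x y b * X u s x z z y);
  last by apply: eq_bigr => z _; exact: R2.
transitivity (\sum_y \sum_x X (~~ u) (~~ s) a x y b * kink u s x y).
  under [RHS]eq_bigr => y _ do rewrite -kink_central.
  rewrite exchange_big; apply: eq_bigr => x _.
  by rewrite -mulr_sumr.
under eq_bigr => y _ do under eq_bigr => x _ do rewrite mulr_sumr.
rewrite exchange_big /= [RHS]exchange_big; apply: eq_bigr => x _.
exact: exchange_big.
Qed.

(** The second kink is a crossing with its loop closed, so the first one slides through
    it, once for each passage. *)
Lemma kink_commute u s v s' :
  kmul (kink u s) (kink v s') = kmul (kink v s') (kink u s).
Proof.
apply: functional_extensionality => a; apply: functional_extensionality => b.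
rewrite /kmul.
transitivity (\sum_y \sum_x kink u s a x * X v s' x y y b).
  rewrite exchange_big; apply: eq_bigr => x _; by rewrite -mulr_sumr.
under eq_bigr => y _ do rewrite kink_central.
have XC x y : X v s' a x y b = X v (~~ s') y b a x by rewrite /X; case: (s').
transitivity (\sum_x \sum_y kink u s x y * X v (~~ s') y b a x).
  rewrite exchange_big; apply: eq_bigr => x _; apply: eq_bigr => y _.
  by rewrite XC mulrC.
under eq_bigr => x _ do rewrite kink_central.
rewrite exchange_big; apply: eq_bigr => y _; rewrite -mulr_suml; congr (_ * _).
by apply: eq_bigr => x _; rewrite /X; case: (s').
Qed.

End Kinks.
Arguments kink {R} V u s.

(** * State sums of words *)

Section Updates.
Variables (X D : finType).

Definition upd (g : {ffun X -> D}) (c : X) (d : D) : {ffun X -> D} :=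
  [ffun x => if x == c then d else g x].

Lemma upd_same g c d : upd g c d c = d.
Proof. by rewrite ffunE eqxx. Qed.

Lemma upd_other g c d x : x != c -> upd g c d x = g x.
Proof. by rewrite ffunE => /negbTE ->. Qed.

Lemma sum_upd (R : comNzRingType) (P : pred {ffun X -> D}) (c : X) (d0 : D)
    (F : {ffun X -> D} -> R) :
  (forall g d, P (upd g c d) = P g) ->
  \sum_(g | P g) F g = \sum_(g | P g && (g c == d0)) \sum_d F (upd g c d).
Proof.
move=> Pupd; rewrite [RHS]exchange_big (partition_big (fun g : {ffun X -> D} => g c) predT) //=.
apply: eq_bigr => d _.
rewrite (reindex_onto (fun g => upd g c d) (fun g => upd g c d0)) /=.
  apply: eq_bigl => g; rewrite Pupd upd_same eqxx andbT; congr (_ && _).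
  apply/eqP/eqP => [<-|gc]; first by rewrite upd_same.
  apply/ffunP => x; rewrite !ffunE.
  by case: eqP => // ->.
move=> g /andP[_ /eqP gc]; apply/ffunP => x; rewrite !ffunE.
by case: eqP => // ->.
Qed.

End Updates.

Section Embedding.
Variables (X X' : finType) (f : X -> X') (new : seq X').
Hypotheses (f_inj : injective f) (new_uniq : uniq new)
  (new_f : forall x, f x \notin new)
  (cover : forall y, (y \in new) || (y \in codom f)).

Lemma prod_embedding (R : comNzRingType) (F : X' -> R) :
  \prod_y F y = (\prod_(y <- new) F y) * \prod_x F (f x).
Proof.
rewrite -(big_map f predT F) -big_cat /=; apply: perm_big.
apply: uniq_perm; first exact: index_enum_uniq.
  rewrite cat_uniq new_uniq map_inj_uniq ?index_enum_uniq // andbT.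
  by apply/hasPn => y /mapP[x _ ->]; exact: new_f.
move=> y; rewrite mem_index_enum mem_cat.
case/orP: (cover y) => [->//|/codomP[x ->]].
by rewrite map_f ?orbT // mem_index_enum.
Qed.

(** Functions with prescribed values at the new points are functions on the old ones. *)
Lemma sum_embedding (R : comNzRingType) (D : finType) (d0 : D)
    (F : {ffun X -> D} -> R) :
  \sum_(g : {ffun X' -> D} | all (fun y => g y == d0) new) F [ffun x => g (f x)] =
  \sum_g F g.
Proof.
pose h (g : {ffun X -> D}) : {ffun X' -> D} :=
  [ffun y => if [pick x | f x == y] is Some x then g x else d0].
have hf g x : h g (f x) = g x.
  rewrite ffunE; case: pickP => [x' /eqP/f_inj -> //|/(_ x)].
  by rewrite eqxx.
rewrite (reindex_onto h (fun g => [ffun x => g (f x)])) /=.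
  apply: eq_big => [g|g _].
    have -> : [ffun x => h g (f x)] = g by apply/ffunP => x; rewrite ffunE hf.
    rewrite eqxx andbT; apply/allP => y yn; rewrite ffunE.
    by case: pickP => // x /eqP fx; move: yn (new_f x); rewrite fx => ->.
  by congr F; apply/ffunP => x; rewrite ffunE hf.
move=> g /allP g0; apply/ffunP => y; rewrite ffunE.
case: pickP => [x /eqP <-|nof]; first by rewrite ffunE.
case/orP: (cover y) => [/g0/eqP -> //|/codomP[x yx]].
by have := nof x; rewrite yx eqxx.
Qed.

End Embedding.

Section Words.
Variables (R : comNzRingType) (V : vertex_model R).
Let C := color V.
Let XT u s := oriented (weight V u) s.

(** The colours before and after a crossing, on strand [false] and on strand [true]. *)
Definition bead : finType := ((C * C) * (C * C))%type.
Definition pass (d : bead) (s : bool) : C * C := if s then d.2 else d.1.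
(** The only bead that a virtual crossing may carry; virtual crossings are
    transparent, see [segment]. *)
Definition bead0 : bead := ((color0 V, color0 V), (color0 V, color0 V)).

Definition kind_weight (k : crossing_kind) (d : bead) : R :=
  match k with
  | Virtual => (d == bead0)%:R
  | Classical u => weight V u d.1.1 d.1.2 d.2.1 d.2.2
  end.

(** The elementary matrix at [p]. *)
Definition unit_kernel (p : C * C) : kernel R C :=
  fun a b => (a == p.1)%:R * (p.2 == b)%:R.

Lemma sum_bead (F : bead -> R) s :
  \sum_d F d = \sum_e \sum_p F (if s then (e, p) else (p, e)).
Proof. by rewrite sum_pair; case: s => //; rewrite exchange_big. Qed.

Lemma sum_crossing u s a b c d :
  \sum_e kind_weight (Classical u) e *
    (unit_kernel (pass e s) a b * unit_kernel (pass e (~~ s)) c d) =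
  XT u s a b c d.
Proof.
transitivity (\sum_e1 \sum_e2 kind_weight (Classical u)
     (if s then (e2, e1) else (e1, e2)) *
   (unit_kernel e1 a b * unit_kernel e2 c d)).
  rewrite (sum_bead _ s) exchange_big /=.
  by apply: eq_bigr => e1 _; apply: eq_bigr => e2 _; case: s.
rewrite !sum_pair.
under eq_bigr => x _ do under eq_bigr => y _ do rewrite sum_pair.
transitivity (\sum_x (a == x)%:R * \sum_y (b == y)%:R * \sum_z (c == z)%:R *
  \sum_t (d == t)%:R * XT u s x y z t).
  rewrite /unit_kernel /=; do 4!(rewrite ?mulr_sumr; apply: eq_bigr => ? _).
  rewrite /XT /swap_arcs; case: s => /=; rewrite ![_ == b]eq_sym ![_ == d]eq_sym /swap_arcs; ring.
by rewrite !sum_deltal.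
Qed.

Lemma sum_virtual F : \sum_d kind_weight Virtual d * F d = F bead0.
Proof. exact: sum_deltal_sym. Qed.

Section Chain.
Variables (X : finType) (kappa : X -> crossing_kind).

(** A passage forces the colours of its bead; a passage through a virtual crossing does
    nothing. *)
Definition segment (g : X -> bead) (p : X * bool) : kernel R C :=
  if is_classical (kappa p.1) then unit_kernel (pass (g p.1) p.2) else @kid R C.

Definition chain (g : X -> bead) (w : seq (X * bool)) : kernel R C :=
  foldr (fun p k => kmul (segment g p) k) (@kid R C) w.

(** The state sum of an open curve, as a matrix indexed by the colours of its two ends. *)
Definition word_matrix (w : seq (X * bool)) : kernel R C := fun a b =>
  \sum_(g : {ffun X -> bead}) (\prod_c kind_weight (kappa c) (g c)) * chain g w a b.

Lemma chain_cat g w1 w2 : chain g (w1 ++ w2) = kmul (chain g w1) (chain g w2).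
Proof.
elim: w1 => [|p w1 IH] /=; first by rewrite kmul1k.
by rewrite IH kmulA.
Qed.

Lemma chain1 g p : chain g [:: p] = segment g p.
Proof. exact: kmulk1. Qed.

Lemma eq_chain g g' w :
  (forall p, p \in w -> pass (g p.1) p.2 = pass (g' p.1) p.2) ->
  chain g w = chain g' w.
Proof.
elim: w => //= p w IH gg'.
rewrite /segment gg' ?mem_head //; congr (kmul _ _).
by apply: IH => q qw; apply: gg'; rewrite inE qw orbT.
Qed.

Lemma chain_upd (g : {ffun X -> bead}) c d w :
  (forall s, (c, s) \notin w) -> chain (upd g c d) w = chain g w.
Proof.
move=> cw; apply: eq_chain => -[x s] xw; rewrite upd_other //=.
by apply: contraL xw => /eqP ->.
Qed.

End Chain.

Lemma chain_rename (X X' : finType) (kappa : X -> crossing_kind)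
    (kappa' : X' -> crossing_kind) (f : X -> X') g w :
  (forall x, kappa' (f x) = kappa x) ->
  chain kappa' g (rename f w) = chain kappa (fun x => g (f x)) w.
Proof.
move=> kf; elim: w => //= p w ->; congr (kmul _ _).
by rewrite /segment /= kf.
Qed.

End Words.
Arguments word_matrix {R} V {X} kappa w.

(** * Sliding a kink along a word *)

Section Expand.
Variables (R : comNzRingType) (C : finType).

Lemma kmul3E (f s g : kernel R C) a b :
  kmul f (kmul s g) a b = \sum_(m : C * C) f a m.1 * g m.2 b * s m.1 m.2.
Proof.
rewrite /kmul sum_pair; apply: eq_bigr => x _; rewrite mulr_sumr.
by apply: eq_bigr => y _; rewrite mulrA mulrAC.
Qed.

Lemma kmul5E (f1 s1 f2 s2 f3 : kernel R C) a b :
  kmul f1 (kmul s1 (kmul f2 (kmul s2 f3))) a b =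
  \sum_(m : C * C) \sum_(n : C * C)
    f1 a m.1 * f2 m.2 n.1 * f3 n.2 b * (s1 m.1 m.2 * s2 n.1 n.2).
Proof.
rewrite kmul3E; apply: eq_bigr => m _; rewrite kmul3E mulr_sumr mulr_suml.
by apply: eq_bigr => n _; ring.
Qed.

Lemma kmul7E (f1 s1 f2 s2 f3 s3 f4 : kernel R C) a b :
  kmul f1 (kmul s1 (kmul f2 (kmul s2 (kmul f3 (kmul s3 f4))))) a b =
  \sum_(m : C * C) \sum_(n : C * C) \sum_(p : C * C)
    f1 a m.1 * f2 m.2 n.1 * f3 n.2 p.1 * f4 p.2 b *
    (s1 m.1 m.2 * s2 n.1 n.2 * s3 p.1 p.2).
Proof.
rewrite kmul3E; apply: eq_bigr => m _; rewrite kmul5E mulr_sumr mulr_suml.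
apply: eq_bigr => n _; rewrite mulr_sumr mulr_suml.
by apply: eq_bigr => p _; ring.
Qed.

End Expand.

Section Slide.
Variables (R : comNzRingType) (V : vertex_model R).
Let C := color V.
Let XT u s := oriented (weight V u) s.
Variables (X : finType) (kappa : X -> crossing_kind).

(** [K] can be moved across any crossing, along each of its strands (take [~~ s] and
    exchange the roles of the pairs). *)
Definition central (K : kernel R C) := forall u s a b c d,
  \sum_x K a x * XT u s x b c d = \sum_x XT u s a x c d * K x b.

Definition insert (K : kernel R C) w1 w2 : kernel R C := fun a b =>
  \sum_(g : {ffun X -> bead V})
    (\prod_c kind_weight (kappa c) (g c)) *
    kmul (chain kappa g w1) (kmul K (chain kappa g w2)) a b.

Lemma sum_kmul_unit (F : C -> C -> R) (K : kernel R C) m m' :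
  \sum_p F p.1 p.2 * kmul K (@unit_kernel R V p) m m' = \sum_x K m x * F x m'.
Proof.
rewrite sum_pair; apply: eq_bigr => x _ /=.
transitivity (\sum_y F x y * K m x * (y == m')%:R).
  apply: eq_bigr => y _; rewrite -mulrA; congr (_ * _).
  rewrite -[in RHS](sum_deltar x (K m)) mulr_suml.
  by apply: eq_bigr => z _; rewrite /unit_kernel mulrA.
by rewrite sum_deltar mulrC.
Qed.

Lemma sum_unit_kmul (F : C -> C -> R) (K : kernel R C) m m' :
  \sum_p F p.1 p.2 * kmul (@unit_kernel R V p) K m m' = \sum_x F m x * K x m'.
Proof.
rewrite sum_pair exchange_big; apply: eq_bigr => y _ /=.
transitivity (\sum_x (m == x)%:R * (F x y * K y m')).
  apply: eq_bigr => x _; rewrite mulrCA; congr (_ * _).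
  rewrite /kmul /unit_kernel /=.
  under eq_bigr => z _ do rewrite -mulrA.
  by rewrite -mulr_sumr sum_deltal.
by rewrite sum_deltal.
Qed.

Lemma insert_nil K w : insert K [::] w = kmul K (word_matrix V kappa w).
Proof.
apply: functional_extensionality => a; apply: functional_extensionality => b.
rewrite /insert /word_matrix /kmul /=.
under [RHS]eq_bigr => x _ do rewrite mulr_sumr.
rewrite [RHS]exchange_big; apply: eq_bigr => g _ /=.
rewrite sum_deltal mulr_sumr; apply: eq_bigr => x _; ring.
Qed.

(** The crossing of [p] absorbs [K] on either side with the same result; no other
    factor of the state sum is affected, since [p] occurs only once. *)
Lemma slide K A p B : central K -> p \notin A ++ B ->
  insert K A (p :: B) = insert K (A ++ [:: p]) B.
Proof.
case: p => c s Kc pAB.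
apply: functional_extensionality => a; apply: functional_extensionality => b.
rewrite /insert.
case kc: (kappa c) => [|u].
  apply: eq_bigr => g _; rewrite chain_cat chain1 /= /segment /= kc /=.
  by rewrite kmul1k kmulk1.
rewrite (@sum_upd _ _ _ predT c (bead0 V)) // [RHS](@sum_upd _ _ _ predT c (bead0 V)) //.
apply: eq_bigr => g _.
rewrite (sum_bead _ s) [RHS](sum_bead _ s); apply: eq_bigr => e _.
pose G p := upd g c (if s then (e, p) else (p, e) : bead V).
have GA p w : (c, s) \notin w ->
    chain kappa (G p) w = chain kappa (G (color0 V, color0 V)) w.
  move=> cw; apply: eq_chain => -[x s'] xw; rewrite /G /=.
  have [xc|xc] := eqVneq x c; last by rewrite !upd_other.
  rewrite xc !upd_same; have: s' != s by apply: contraNneq cw => <-; rewrite -xc.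
  by clear; case: s s' => [] [].
move: pAB; rewrite mem_cat negb_or => /andP[pA pB].
pose W := \prod_(x | x != c) kind_weight (kappa x) (g x).
have GW p : \prod_x kind_weight (kappa x) (G p x) =
    XT u s p.1 p.2 e.1 e.2 * W.
  rewrite (bigD1 c) //= /G upd_same kc; congr (_ * _).
    by rewrite /XT; case: (s).
  by apply: eq_bigr => x xc; rewrite upd_other.
have GS p : segment kappa (G p) (c, s) = @unit_kernel R V p.
  by rewrite /segment /= kc /= /G upd_same; case: (s).
pose chA := chain kappa (G (color0 V, color0 V)) A.
pose chB := chain kappa (G (color0 V, color0 V)) B.
have lin (F : C * C -> kernel R C) :
    \sum_p (XT u s p.1 p.2 e.1 e.2 * W) * kmul chA (kmul (F p) chB) a b =
    \sum_(m : C * C) chA a m.1 * chB m.2 b * W *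
       \sum_(p : C * C) XT u s p.1 p.2 e.1 e.2 * F p m.1 m.2.
  under eq_bigr => p _ do rewrite kmul3E mulr_sumr.
  rewrite exchange_big; apply: eq_bigr => m _; rewrite mulr_sumr.
  by apply: eq_bigr => p _; ring.
transitivity (\sum_(p : C * C) XT u s p.1 p.2 e.1 e.2 * W *
   kmul chA (kmul (kmul K (@unit_kernel R V p)) chB) a b).
  by apply: eq_bigr => p _; rewrite GW /= GS !GA // -kmulA.
transitivity (\sum_(p : C * C) XT u s p.1 p.2 e.1 e.2 * W *
   kmul chA (kmul (kmul (@unit_kernel R V p) K) chB) a b); last first.
  by apply: eq_bigr => p _; rewrite GW chain_cat chain1 GS !GA // -!kmulA.
rewrite !lin; apply: eq_bigr => m _; congr (_ * _).
rewrite (sum_kmul_unit (fun x y => XT u s x y e.1 e.2)).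
rewrite (sum_unit_kmul (fun x y => XT u s x y e.1 e.2)).
exact: Kc.
Qed.

Lemma slide_word K A B : central K -> uniq (A ++ B) ->
  insert K A B = kmul K (word_matrix V kappa (A ++ B)).
Proof.
move=> Kc; elim/last_ind: A B => [|A p IH] B; first by rewrite insert_nil.
rewrite -cats1 -catA /= => U; rewrite -slide ?IH //.
by move: U; rewrite -cat1s uniq_catCA /= => /andP[].
Qed.

End Slide.
Arguments central {R} V K.

(** * The first two moves *)

Section Moves.
Variables (R : comNzRingType) (V : vertex_model R).
Let C := color V.
Let XT u s := oriented (weight V u) s.

Section Extension.
Variables (X X' : finType) (kappa : X -> crossing_kind)
  (kappa' : X' -> crossing_kind) (f : X -> X').
Hypotheses (f_inj : injective f) (kf : forall x, kappa' (f x) = kappa x).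

Let kappa_weight (g : {ffun X -> bead V}) := \prod_x kind_weight (kappa x) (g x).

Lemma word_matrix_rename w : (forall y, y \in codom f) ->
  word_matrix V kappa' (rename f w) = word_matrix V kappa w.
Proof.
move=> cover; apply: functional_extensionality => a.
apply: functional_extensionality => b.
rewrite /word_matrix -[RHS](sum_embedding (new := [::]) f_inj _ _ (bead0 V)) //.
apply: eq_bigr => g _.
rewrite (chain_rename _ _ kf) (prod_embedding (f := f) (new := [::])) // big_nil mul1r.
congr (_ * _); first by apply: eq_bigr => x _; rewrite kf ffunE.
by congr (_ a b); apply: eq_chain => p _; rewrite ffunE.
Qed.

Section OneNew.
Variable c : X'.
Hypotheses (c_new : forall x, f x != c)
  (cover : forall y, (y == c) || (y \in codom f)).

Lemma word_matrix_new1 w : word_matrix V kappa' w = fun a b =>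
  \sum_(g : {ffun X' -> bead V} | g c == bead0 V)
    kappa_weight [ffun x => g (f x)] *
    \sum_d kind_weight (kappa' c) d * chain kappa' (upd g c d) w a b.
Proof.
apply: functional_extensionality => a; apply: functional_extensionality => b.
rewrite /word_matrix (@sum_upd _ _ _ predT c (bead0 V)) //=.
apply: eq_bigr => g _; rewrite mulr_sumr; apply: eq_bigr => d _.
rewrite (prod_embedding (f := f) (new := [:: c])) //; first last.
- by move=> y; rewrite inE.
- by move=> x; rewrite inE.
rewrite big_seq1 upd_same mulrAC mulrC; congr (_ * _).
  by apply: eq_bigr => x _; rewrite upd_other // kf ffunE.
Qed.

Lemma chain_upd_rename g d w :
  chain kappa' (upd g c d) (rename f w) =
  chain kappa ([ffun x => g (f x)] : {ffun X -> bead V}) w.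
Proof.
rewrite (chain_rename _ _ kf); apply: eq_chain => p _.
by rewrite upd_other // ffunE.
Qed.

Definition kind_kink (k : crossing_kind) s : kernel R C :=
  if k is Classical u then kink V u s else @kid R C.

Lemma kind_kink_central k s : central V (kind_kink k s).
Proof.
case: k => [|u] v s' a b c' d; last exact: kink_central.
by rewrite sum_deltal sum_deltar.
Qed.

(** The new crossing is summed first, which leaves a kink at its place; this then
    slides to the beginning of the word. *)
Lemma word_matrix_R1 A B s : uniq (A ++ B) ->
  word_matrix V kappa' (rename f A ++ [:: (c, s); (c, ~~ s)] ++ rename f B) =
  kmul (kind_kink (kappa' c) s) (word_matrix V kappa (A ++ B)).
Proof.
move=> U; rewrite -slide_word //; last exact: kind_kink_central.
rewrite word_matrix_new1.
apply: functional_extensionality => a; apply: functional_extensionality => b.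
rewrite /insert -[RHS](sum_embedding (f := f) (new := [:: c]) f_inj _ _ (bead0 V)) //;
  first last.
- by move=> y; rewrite inE.
- by move=> x; rewrite inE.
apply: eq_big => [g|g _]; first by rewrite /= andbT.
congr (_ * _).
under eq_bigr => d _ do rewrite chain_cat /= !chain_upd_rename.
set cA := chain _ _ A; set cB := chain _ _ B.
case kc: (kappa' c) => [|u].
  under eq_bigr => d _ do rewrite /segment /= kc /= !kmul1k.
  by rewrite sum_virtual /kind_kink kmul1k.
have lin (F : bead V -> kernel R C) (z : bead V -> R) :
    \sum_d z d * kmul cA (kmul (F d) cB) a b =
    \sum_(m : C * C) cA a m.1 * cB m.2 b * \sum_d z d * F d m.1 m.2.
  under eq_bigr => d _ do rewrite kmul3E mulr_sumr.
  rewrite exchange_big; apply: eq_bigr => m _; rewrite mulr_sumr.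
  by apply: eq_bigr => d _; ring.
under eq_bigr => d _ do rewrite [kmul (segment _ _ (c, s)) _]kmulA.
rewrite lin kmul3E; apply: eq_bigr => m _; congr (_ * _).
rewrite /= /kink.
under [RHS]eq_bigr => x _ do rewrite -sum_crossing.
rewrite exchange_big; apply: eq_bigr => d _.
rewrite -mulr_sumr; congr (_ * _).
by rewrite /segment /= kc /= upd_same.
Qed.

End OneNew.
Section TwoNew.
Variables a b : X'.
Hypotheses (ab : a != b) (ab_new : forall x, (f x != a) && (f x != b))
  (cover : forall y, (y \in [:: a; b]) || (y \in codom f)).

Let upd2 (g : {ffun X' -> bead V}) da db := upd (upd g b db) a da.

Let upd2_a g da db : upd2 g da db a = da. Proof. exact: upd_same. Qed.
Let upd2_b g da db : upd2 g da db b = db.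
Proof. by rewrite upd_other 1?eq_sym // upd_same. Qed.
Let upd2_f g da db x : upd2 g da db (f x) = g (f x).
Proof. by have /andP[fa fb] := ab_new x; rewrite !upd_other. Qed.

Lemma word_matrix_new2 w : word_matrix V kappa' w = fun x y =>
  \sum_(g : {ffun X' -> bead V} | all (fun z => g z == bead0 V) [:: a; b])
    kappa_weight [ffun x => g (f x)] *
    \sum_db \sum_da kind_weight (kappa' a) da * kind_weight (kappa' b) db *
      chain kappa' (upd2 g da db) w x y.
Proof.
apply: functional_extensionality => x; apply: functional_extensionality => y.
rewrite /word_matrix (@sum_upd _ _ _ predT a (bead0 V)) //=.
rewrite (@sum_upd _ _ _ _ b (bead0 V)) //=; last first.
  by move=> g d; rewrite upd_other.
apply: eq_big => [g|g _]; first by rewrite andbT.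
rewrite mulr_sumr; apply: eq_bigr => db _; rewrite mulr_sumr.
apply: eq_bigr => da _; rewrite -/(upd2 g da db).
rewrite (prod_embedding (f := f) (new := [:: a; b])) //; first last.
- by move=> z; rewrite !inE negb_or; exact: ab_new.
- by rewrite /= inE ab.
rewrite big_cons big_seq1 upd2_a upd2_b mulrAC mulrC; congr (_ * _).
by apply: eq_bigr => z _; rewrite upd2_f kf ffunE.
Qed.

Let chain_upd2 g da db w :
  chain kappa' (upd2 g da db) (rename f w) =
  chain kappa ([ffun x => g (f x)] : {ffun X -> bead V}) w.
Proof.
rewrite (chain_rename _ _ kf); apply: eq_chain => p _.
by rewrite upd2_f ffunE.
Qed.

(** Summation over the two new crossings gives the left-hand side of [unitary] at the
    ends of the two arcs, hence a pair of identity kernels. *)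
Lemma word_matrix_R2 A B D s (same_direction : bool) :
  bigon_kinds (kappa' a) (kappa' b) ->
  word_matrix V kappa' (rename f A ++ [:: (a, s); (b, ~~ s)] ++ rename f B ++
      (if same_direction then [:: (a, ~~ s); (b, s)] else [:: (b, s); (a, ~~ s)])
      ++ rename f D) =
  word_matrix V kappa (A ++ B ++ D).
Proof.
move=> kab; rewrite word_matrix_new2.
apply: functional_extensionality => x; apply: functional_extensionality => y.
rewrite /word_matrix -(sum_embedding (f := f) (new := [:: a; b]) f_inj _ _ (bead0 V)) //;
  last by move=> z; rewrite !inE negb_or; exact: ab_new.
apply: eq_bigr => g _; congr (_ * _).
under eq_bigr => db _ do under eq_bigr => da _ do
  rewrite !chain_cat !chain_upd2.
rewrite !chain_cat.
set cA := chain _ _ A; set cB := chain _ _ B; set cD := chain _ _ D.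
set w1 := [:: (a, s); _]; set w2 := if _ then _ else _.
move: kab; case ka: (kappa' a) => [|u]; case kb: (kappa' b) => [|v] // uv.
  have w1E g' : chain kappa' g' w1 = @kid R C.
    by rewrite /w1 /= /segment /= ka kb /= !kmul1k.
  have w2E g' : chain kappa' g' w2 = @kid R C.
    by rewrite /w2; case: ifP => _; rewrite /= /segment /= ka kb /= !kmul1k.
  under eq_bigr => db _ do under eq_bigr => da _ do rewrite w1E w2E !kmul1k -mulrA.
  under eq_bigr => db _ do rewrite (sum_virtual (fun=> _)).
  exact: (sum_virtual (fun=> _)).
have {uv} uv : v = ~~ u by move: uv; rewrite /=; clear; case: u v => [] [].
subst v.
have -> : kmul cA (kmul cB cD) =
    kmul cA (kmul (@kid R C) (kmul cB (kmul (@kid R C) cD))) by rewrite !kmul1k.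
rewrite [RHS]kmul5E.
under eq_bigr => db _ do under eq_bigr => da _ do
  (rewrite kmul5E mulr_sumr; under eq_bigr => m _ do rewrite mulr_sumr).
rewrite exchange_big22; apply: eq_bigr => m _; apply: eq_bigr => n _.
transitivity (cA x m.1 * cB m.2 n.1 * cD n.2 y * \sum_p \sum_q
  (if same_direction then XT u s m.1 p n.1 q * XT (~~ u) (~~ s) p m.2 q n.2
   else XT u s m.1 p q n.2 * XT (~~ u) (~~ s) p m.2 n.1 q)); last first.
  congr (_ * _); case: (same_direction); first exact: (weight_R2 V u s false).
  by have := weight_R2 V u s true m.1 m.2 n.2 n.1; rewrite [n.2 == _]eq_sym.
under eq_bigr => db _ do under eq_bigr => da _ do rewrite mulrCA.
under eq_bigr => db _ do rewrite -mulr_sumr.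
rewrite -mulr_sumr; congr (_ * _).
have distr (Y Z : finType) (F : Y -> R) (G : Z -> R) :
  (\sum_i F i) * (\sum_j G j) = \sum_i \sum_j F i * G j by exact: big_distrlr.
have chain2 g' p q m0 m0' : is_classical (kappa' p.1) -> is_classical (kappa' q.1) ->
    chain kappa' g' [:: p; q] m0 m0' =
    \sum_t unit_kernel (pass (g' p.1) p.2) m0 t * unit_kernel (pass (g' q.1) q.2) t m0'.
  by move=> kp kq; rewrite /= kmulk1 /kmul /segment kp kq.
have XTE u' s' m1 m2 n1 n2 : XT u' s' m1 m2 n1 n2 =
  \sum_d kind_weight (Classical u') d * (unit_kernel (pass d s') m1 m2 *
     unit_kernel (pass d (~~ s')) n1 n2) by rewrite sum_crossing.
transitivity (\sum_p \sum_q \sum_db \sum_da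
  kind_weight (Classical u) da * kind_weight (Classical (~~ u)) db *
  (unit_kernel (pass da s) m.1 p * unit_kernel (pass db (~~ s)) p m.2 *
   if same_direction then
     unit_kernel (pass da (~~ s)) n.1 q * unit_kernel (pass db s) q n.2
   else unit_kernel (pass db s) n.1 q * unit_kernel (pass da (~~ s)) q n.2)).
  rewrite exchange_big22; apply: eq_bigr => db _; apply: eq_bigr => da _.
  rewrite /w1 /w2; case: (same_direction); rewrite !chain2 /= ?ka ?kb // upd2_a upd2_b.
    rewrite distr mulr_sumr; apply: eq_bigr => p _.
    by rewrite mulr_sumr; apply: eq_bigr => q _.
  rewrite distr mulr_sumr; apply: eq_bigr => p _.
  by rewrite mulr_sumr; apply: eq_bigr => q _.
apply: eq_bigr => p _; apply: eq_bigr => q _.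
rewrite exchange_big.
rewrite (_ : (if same_direction then _ else _) = if same_direction
  then (\sum_d kind_weight (Classical u) d *
         (unit_kernel (pass d s) m.1 p * unit_kernel (pass d (~~ s)) n.1 q)) *
       (\sum_d kind_weight (Classical (~~ u)) d *
         (unit_kernel (pass d (~~ s)) p m.2 * unit_kernel (pass d s) q n.2))
  else (\sum_d kind_weight (Classical u) d *
         (unit_kernel (pass d s) m.1 p * unit_kernel (pass d (~~ s)) q n.2)) *
       (\sum_d kind_weight (Classical (~~ u)) d *
         (unit_kernel (pass d (~~ s)) p m.2 * unit_kernel (pass d s) n.1 q)));
  last by case: (same_direction); rewrite !XTE negbK.
case: (same_direction); rewrite distr; do 2!(apply: eq_bigr => ? _).
  by rewrite [RHS]mulrACA; congr (_ * _); rewrite mulrACA.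
by rewrite [RHS]mulrACA; congr (_ * _); rewrite [X in _ * X]mulrC mulrACA.
Qed.

End TwoNew.
End Extension.
End Moves.
Arguments kind_kink {R} V k s.

(** * The third move *)

Section Triangle.
Variables (R : comNzRingType) (V : vertex_model R).
Let C := color V.
Let XT u s := oriented (weight V u) s.
Variables (X : finType) (kappa : X -> crossing_kind).

Lemma chain_pair (g : X -> bead V) o p q m m' :
  is_classical (kappa p.1) -> is_classical (kappa q.1) ->
  chain kappa g (in_order o p q) m m' =
  \sum_x unit_kernel (pass (g p.1) p.2) (first_in o m x) (first_out o m' x) *
         unit_kernel (pass (g q.1) q.2) (first_in (~~ o) m x) (first_out (~~ o) m' x).
Proof.
move=> kp kq; case: o; rewrite /= kmulk1 /kmul /segment kp kq //.
by apply: eq_bigr => x _; rewrite mulrC.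
Qed.

(** At least one of two neighbours is transparent, so their order is irrelevant. *)
Lemma chain_virtual (g : X -> bead V) o p q :
  ~~ is_classical (kappa p.1) || ~~ is_classical (kappa q.1) ->
  chain kappa g (in_order o p q) = chain kappa g (in_order (~~ o) p q).
Proof.
by case: o; rewrite /= /segment => /orP[] /negbTE ->; rewrite ?kmul1k ?kmulk1.
Qed.

Lemma uniq_triangle A B D E (a b c : X) s12 s13 s23 side :
  uniq (triangle_word A B D E a b c s12 s13 s23 side) ->
  [/\ a != b, a != c & b != c] /\
  forall y s, y \in [:: a; b; c] -> (y, s) \notin A ++ B ++ D ++ E.
Proof.
move=> U.
have P : perm_eq (triangle_word A B D E a b c s12 s13 s23 side)
    ([:: (a, s12); (a, ~~ s12); (b, s13); (b, ~~ s13); (c, s23); (c, ~~ s23)] ++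
     (A ++ B ++ D ++ E)).
  apply/permP => q; rewrite /triangle_word /in_order.
  by case: ifP => _; case: ifP => _; case: ifP => _; rewrite !count_cat /=; lia.
rewrite (perm_uniq P) cat_uniq in U; case/and3P: U => U1 /hasPn U2 _.
split.
  move: U1; clear; rewrite /= !inE !negb_or -!andbA !xpair_eqE.
  case: (eqVneq a b) => [_|_]; first by case: s12 s13 => [] []; rewrite //= ?andbF.
  case: (eqVneq a c) => [_|_]; first by case: s12 s23 => [] []; rewrite //= ?andbF.
  by case: (eqVneq b c) => [_|//]; case: s13 s23 => [] []; rewrite //= ?andbF.
move=> y s ys; apply/negP => /U2 /negP; apply.
move: ys; clear; rewrite !inE !xpair_eqE => /or3P[] /eqP ->; rewrite eqxx;
  by case: s12; case: s13; case: s23; case: s; rewrite ?orbT.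
Qed.

Lemma triangle_word_chain g A B D E (a b c : X) s12 s13 s23 side :
  chain kappa g (triangle_word A B D E a b c s12 s13 s23 side) =
  kmul (chain kappa g A) (kmul
    (chain kappa g (in_order (side (+) s13) (a, s12) (b, s13))) (kmul
  (chain kappa g B) (kmul
    (chain kappa g (in_order (side (+) s23) (a, ~~ s12) (c, s23))) (kmul
  (chain kappa g D) (kmul
    (chain (V := V) kappa g
      (in_order (side (+) s12 (+) s13 (+) s23) (b, ~~ s13) (c, ~~ s23)))
  (chain kappa g E)))))).
Proof. by rewrite /triangle_word !chain_cat. Qed.

(** Either at least two crossings are virtual, and each of the three arcs passes a
    transparent crossing there; or summation over the three crossings gives
    [triangle] at the ends of the arcs. *)
Lemma word_matrix_R3 A B D E (a b c : X) s12 s13 s23 side :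
  triangle_kinds (kappa a) (kappa b) (kappa c) s12 s13 s23 ->
  uniq (triangle_word A B D E a b c s12 s13 s23 side) ->
  word_matrix V kappa (triangle_word A B D E a b c s12 s13 s23 side) =
  word_matrix V kappa (triangle_word A B D E a b c s12 s13 s23 (~~ side)).
Proof.
move=> kabc U; have [[ab ac bc] notin] := uniq_triangle U.
apply: functional_extensionality => x; apply: functional_extensionality => y.
rewrite /word_matrix.
have virt : [|| ~~ is_classical (kappa a) && ~~ is_classical (kappa b),
                ~~ is_classical (kappa a) && ~~ is_classical (kappa c) |
                ~~ is_classical (kappa b) && ~~ is_classical (kappa c)] ->
  forall g, chain kappa g (triangle_word A B D E a b c s12 s13 s23 side) =
  chain (V := V) kappa g (triangle_word A B D E a b c s12 s13 s23 (~~ side)).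
  move=> v2 g; rewrite !triangle_word_chain !addNb.
  rewrite (chain_virtual g (side (+) s13)); last first.
    by case/or3P: v2 => /andP[va vb]; rewrite /= ?va ?vb ?orbT.
  rewrite (chain_virtual g (side (+) s23)); last first.
    by case/or3P: v2 => /andP[va vb]; rewrite /= ?va ?vb ?orbT.
  rewrite (chain_virtual g (side (+) s12 (+) s13 (+) s23)) //.
  by case/or3P: v2 => /andP[va vb]; rewrite /= ?va ?vb ?orbT.
case: (boolP [|| ~~ is_classical (kappa a) && ~~ is_classical (kappa b),
                ~~ is_classical (kappa a) && ~~ is_classical (kappa c) |
                ~~ is_classical (kappa b) && ~~ is_classical (kappa c)]) => [/virt v2|cl].
  by apply: eq_bigr => g _; rewrite v2.
have [u [v [w [ka kb kc]]]] : exists u v w,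
    [/\ kappa a = Classical u, kappa b = Classical v & kappa c = Classical w].
  case: (kappa a) (kappa b) (kappa c) cl kabc => [|u] [|v] [|w] //.
  by exists u, v, w.
rewrite ka kb kc in kabc.
do 2![rewrite (@sum_upd _ _ _ predT a (bead0 V)) //=;
 rewrite (@sum_upd _ _ _ _ b (bead0 V)) //=; last (by move=> g d; rewrite upd_other);
 rewrite (@sum_upd _ _ _ _ c (bead0 V)) //=;
   last (by move=> g d; rewrite !upd_other // eq_sym); symmetry].
apply: eq_bigr => g _.
pose G dc db da := upd (upd (upd g c dc) b db) a da.
pose W := \prod_(z | [&& z != a, z != b & z != c]) kind_weight (kappa z) (g z).
have [ba ca cb] : [/\ b != a, c != a & c != b] by rewrite ![_ == a]eq_sym [c == b]eq_sym.
have Ga dc db da : G dc db da a = da by exact: upd_same.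
have Gb dc db da : G dc db da b = db.
  by rewrite /G upd_other // upd_same.
have Gc dc db da : G dc db da c = dc.
  by rewrite /G upd_other // upd_other // upd_same.
have GW dc db da : \prod_z kind_weight (kappa z) (G dc db da z) =
    kind_weight (Classical u) da * kind_weight (Classical v) db *
    kind_weight (Classical w) dc * W.
  rewrite (bigD1 a) // (bigD1 b) // (bigD1 c) /=; last by rewrite ca.
  rewrite Ga Gb Gc ka kb kc !mulrA; congr (_ * _).
  apply: eq_big => z; first by rewrite andbA.
  by case/andP => /andP[za zb] zc; rewrite !upd_other.
have Gch dc db da l : {subset l <= A ++ B ++ D ++ E} ->
    chain kappa (G dc db da) l = chain kappa g l.
  by move=> lw; rewrite !chain_upd // => s; apply/negP => /lw; apply/negP;
    apply: notin; rewrite !inE eqxx ?orbT.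
pose P m n p := chain kappa g A x m.1 * chain kappa g B m.2 n.1 *
  chain kappa g D n.2 p.1 * chain kappa g E p.2 y * W.
(* Only the three factors of [triangle] depend on the side. *)
have main side' : \sum_dc \sum_db \sum_da
    \prod_z kind_weight (kappa z) (G dc db da z) *
    chain kappa (G dc db da)
      (triangle_word A B D E a b c s12 s13 s23 side') x y =
  \sum_m \sum_n \sum_p P m n p *
    triangle (side' (+) s13) (side' (+) s23) (side' (+) s12 (+) s13 (+) s23)
      (XT u s12) (XT v s13) (XT w s23) m.1 m.2 n.1 n.2 p.1 p.2.
  under eq_bigr => dc _ do under eq_bigr => db _ do under eq_bigr => da _ do
    (rewrite GW triangle_word_chain kmul7E mulr_sumr;
     under eq_bigr => m _ do
       (rewrite mulr_sumr; under eq_bigr => n _ do rewrite mulr_sumr)).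
  rewrite exchange_big33.
  apply: eq_bigr => m _; apply: eq_bigr => n _; apply: eq_bigr => p _.
  set o1 := side' (+) s13; set o2 := side' (+) s23; set o3 := _ (+) s23.
  pose unit := @unit_kernel R V.
  have XTE u' s' m1 m2 n1 n2 : XT u' s' m1 m2 n1 n2 =
    \sum_d kind_weight (Classical u') d * (unit (pass d s') m1 m2 *
     unit (pass d (~~ s')) n1 n2) by rewrite sum_crossing.
  have sA : {subset A <= A ++ B ++ D ++ E} by move=> z zA; rewrite mem_cat zA.
  have sB : {subset B <= A ++ B ++ D ++ E}.
    by move=> z zB; rewrite !mem_cat zB orbT.
  have sD : {subset D <= A ++ B ++ D ++ E}.
    by move=> z zD; rewrite !mem_cat zD !orbT.
  have sE : {subset E <= A ++ B ++ D ++ E}.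
    by move=> z zE; rewrite !mem_cat zE !orbT.
  transitivity (\sum_dc \sum_db \sum_da P m n p * \sum_t1 \sum_t2 \sum_t3
    (kind_weight (Classical u) da * kind_weight (Classical v) db *
     kind_weight (Classical w) dc *
    ((unit (pass da s12) (first_in o1 m.1 t1) (first_out o1 m.2 t1) *
      unit (pass db s13) (first_in (~~ o1) m.1 t1) (first_out (~~ o1) m.2 t1)) *
     (unit (pass da (~~ s12)) (first_in o2 n.1 t2) (first_out o2 n.2 t2) *
      unit (pass dc s23) (first_in (~~ o2) n.1 t2) (first_out (~~ o2) n.2 t2)) *
     (unit (pass db (~~ s13)) (first_in o3 p.1 t3) (first_out o3 p.2 t3) *
      unit (pass dc (~~ s23)) (first_in (~~ o3) p.1 t3) (first_out (~~ o3) p.2 t3))))).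
    apply: eq_bigr => dc _; apply: eq_bigr => db _; apply: eq_bigr => da _.
    rewrite (Gch _ _ _ A) // (Gch _ _ _ B) // (Gch _ _ _ D) // (Gch _ _ _ E) //.
    rewrite !chain_pair ?ka ?kb ?kc // Ga Gb Gc /P.
    under [in RHS]eq_bigr => t1 _ do
      (under eq_bigr => t2 _ do rewrite -mulr_sumr; rewrite -mulr_sumr).
    rewrite -[in RHS]mulr_sumr sum_mul3 !mulrA; congr (_ * _); ring.
  under eq_bigr => dc _ do (under eq_bigr => db _ do rewrite -mulr_sumr;
    rewrite -mulr_sumr).
  rewrite -mulr_sumr; congr (_ * _); rewrite exchange_big33 /triangle.
  apply: eq_bigr => t1 _; apply: eq_bigr => t2 _; apply: eq_bigr => t3 _.
  rewrite !XTE sum_mul3 [RHS]exchange_big /=.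
  under [RHS]eq_bigr => db _ do rewrite exchange_big /=.
  rewrite [RHS]exchange_big; do 3!(apply: eq_bigr => ? _); ring.
rewrite !main; do 3!(apply: eq_bigr => ? _); congr (_ * _).
by rewrite !addNb; exact: (weight_R3 V _ _ _ _ _ _ side kabc).
Qed.

End Triangle.

(** * Equivalent long diagrams *)

Lemma passages_uniq (D : curve_diagram) : uniq (passages D).
Proof. by rewrite (perm_uniq (passages_once D)) enum_uniq. Qed.

Lemma mem_passages (D : curve_diagram) p : p \in passages D.
Proof. by rewrite (perm_mem (passages_once D)) mem_enum. Qed.

Lemma mem_rename (X Y : finType) (f : X -> Y) w y s :
  (y, s) \in rename f w -> y \in codom f.
Proof. by case/mapP => p _ [-> _]; exact: codom_f. Qed.

Section Invariance.
Variable (R : comNzRingType).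

Definition diagram_matrix (V : vertex_model R) (D : curve_diagram) :=
  word_matrix V (@kind D) (passages D).

Arguments diagram_matrix : clear implicits.

Lemma matrix_isotopy V D D' : planar_isotopy D D' ->
  diagram_matrix V D' = diagram_matrix V D.
Proof.
case=> f [[f_inj kf] wD']; rewrite /diagram_matrix wD'.
apply: word_matrix_rename => // y.
by have := mem_passages (y, true); rewrite wD'; exact: mem_rename.
Qed.

(** The kink does not depend on the model, which allows one choice of kinks for all
    cables at once. *)
Lemma matrix_R1 D D' : reidemeister1 D D' -> exists k s,
  forall V, diagram_matrix V D' = kmul (kind_kink V k s) (diagram_matrix V D).
Proof.
case=> f [[f_inj kf] [A [B [c [s [wD wD']]]]]].
exists (kind c), s => V; rewrite /diagram_matrix wD wD'.
have U := passages_uniq D'; have U' := passages_uniq D.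
apply: word_matrix_R1 => //; last by rewrite -wD.
- move=> x; apply/negP => /eqP fx.
  have : (x, s) \in A ++ B by rewrite -wD mem_passages.
  rewrite mem_cat => xs.
  move: U; rewrite wD' uniq_catCA /= => /and3P[].
  rewrite inE negb_or mem_cat => /andP[_ /norP[nA nB]] _ _.
  by case/orP: xs => /(map_f (fun p => (f p.1, p.2))) /=; rewrite fx; apply/negP.
move=> y; have := mem_passages (y, true); rewrite wD' !mem_cat !inE !xpair_eqE.
case/or3P => [/mem_rename ->||/mem_rename ->]; rewrite ?orbT //.
by case/orP => /andP[-> _].
Qed.

Lemma matrix_R2 V D D' : reidemeister2 D D' ->
  diagram_matrix V D' = diagram_matrix V D.
Proof.
case=> f [[f_inj kf] [A [B [E [a [b [s [same [kab [wD wD']]]]]]]]]].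
rewrite /diagram_matrix wD wD'.
have P : perm_eq (passages D') ([:: (a, s); (a, ~~ s); (b, s); (b, ~~ s)] ++
    rename f (passages D)).
  rewrite wD wD' /rename !map_cat; apply/permP => q.
  by case: (same); rewrite !count_cat /=; lia.
have := passages_uniq D'; rewrite (perm_uniq P) cat_uniq => /and3P[U1 /hasPn U2 _].
have notf x t : (f x, t) \notin [:: (a, s); (a, ~~ s); (b, s); (b, ~~ s)].
  by apply: U2; rewrite (map_f (fun p => (f p.1, p.2)) (mem_passages (x, t))).
apply: word_matrix_R2 => //.
- by apply: contraTneq U1 => ->; rewrite /= !inE eqxx ?orbT ?andbF.
- move=> x; have := notf x s; rewrite !inE !xpair_eqE !negb_or eqxx.
  by rewrite !andbT => /and4P[-> _ -> _].
move=> y; have := mem_passages (y, true); rewrite (perm_mem P) mem_cat.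
case/orP => [|/mem_rename ->]; last by rewrite orbT.
by rewrite !inE !xpair_eqE => /or4P[] /andP[-> _]; rewrite ?orbT.
Qed.

Lemma matrix_R3 V D D' : reidemeister3 D D' ->
  diagram_matrix V D' = diagram_matrix V D.
Proof.
case=> f [[f_inj kf] [A [B [E [F [a [b [c [s12 [s13 [s23 [side [k [wD wD']]]]]]]]]]]]]].
rewrite /diagram_matrix wD' (word_matrix_rename V f_inj kf); last first.
  by move=> y; have := mem_passages (y, true); rewrite wD'; exact: mem_rename.
rewrite -word_matrix_R3 //; first by rewrite wD.
by rewrite -wD passages_uniq.
Qed.

Definition kinks (V : vertex_model R) u (l : seq bool) : kernel R (color V) :=
  foldr (fun s k => kmul (kink V u s) k) (@kid R _) l.

Arguments kinks : clear implicits.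

Lemma kinks_cat V u l1 l2 :
  kinks V u (l1 ++ l2) = kmul (kinks V u l1) (kinks V u l2).
Proof.
by elim: l1 => [|s l1 IH] /=; [rewrite kmul1k | rewrite IH kmulA].
Qed.

Lemma kink_kinks V u s l :
  kmul (kink V u s) (kinks V u l) = kmul (kinks V u l) (kink V u s).
Proof.
elim: l => [|t l IH] /=; first by rewrite kmul1k kmulk1.
by rewrite kmulA kink_commute -kmulA IH kmulA.
Qed.

Lemma kinks_commute V u l1 l2 :
  kmul (kinks V u l1) (kinks V u l2) = kmul (kinks V u l2) (kinks V u l1).
Proof.
elim: l1 => [|t l IH] /=; first by rewrite kmul1k kmulk1.
by rewrite -kmulA IH !kmulA kink_kinks.
Qed.

(** A new kink of kind [~~ u] is compensated by a kink of kind [u], by [kinkK]. *)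
Lemma long_move_matrix u K K' : long_move K K' -> exists k k' : seq bool,
  forall V, kmul (kinks V u k) (diagram_matrix V K) =
            kmul (kinks V u k') (diagram_matrix V K').
Proof.
case=> [iso|/matrix_R1[k [s H]]|r2|r3].
- by exists [::], [::] => V; rewrite /= !kmul1k (matrix_isotopy V iso).
- case: k H => [|v] H.
    by exists [::], [::] => V; rewrite /= !kmul1k H /= kmul1k.
  have [vu|vu] := eqVneq v u.
    by exists [:: s], [::] => V; rewrite /= kmulk1 kmul1k H /= vu.
  have {vu} vu : v = ~~ u by case: v u vu {H} => [] [].
  exists [::], [:: ~~ s] => V; rewrite /= kmulk1 kmul1k H /= vu.
  by rewrite kmulA -{2}[s]negbK kinkK kmul1k.
- by exists [::], [::] => V; rewrite /= !kmul1k (matrix_R2 V r2).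
by exists [::], [::] => V; rewrite /= !kmul1k (matrix_R3 V r3).
Qed.

(** Kinks of kind [u] commute, so that the equations of consecutive moves can be
    combined.  It is essential that the kinks are chosen before the model. *)
Lemma long_equivalent_matrix u K K' : long_equivalent K K' ->
  exists k k' : seq bool, forall V,
    kmul (kinks V u k) (diagram_matrix V K) =
    kmul (kinks V u k') (diagram_matrix V K').
Proof.
elim=> {K K'} [K K' /(long_move_matrix u) //|K|K K' _ [k [k' H]]|
  K K' K'' _ [k [k' H]] _ [l [l' H']]].
- by exists [::], [::].
- by exists k', k => V; rewrite H.
exists (l ++ k), (k' ++ l') => V.
rewrite !kinks_cat -!kmulA H -H' !kmulA; congr (kmul _ _).
exact: kinks_commute.
Qed.

End Invariance.

Arguments diagram_matrix {R} V D.
Arguments kinks {R} V u l.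

(** * Gauss codes and their closures *)

(** A closed or open curve without virtual crossings and without a plane. *)
Record gauss_code := GaussCode {
  node : finType;
  sign : node -> bool;
  code : seq (node * bool)
}.

Definition full (G : gauss_code) : Prop := uniq (code G) /\ forall p, p \in code G.

Definition add_kink (u s : bool) (G : gauss_code) : gauss_code :=
  @GaussCode (option (node G)) (fun c => if c is Some x then sign x else u)
    ([:: (None, s); (None, ~~ s)] ++ rename Some (code G)).

Definition over_strand (k : crossing_kind) : bool :=
  if k is Classical u then u else false.

Definition classical_code (K : long_diagram) : gauss_code :=
  @GaussCode (classical_crossing (Cl K)) (fun c => over_strand (kind (val c)))
    (classical_passages (Cl K)).

Section Matrix.
Variables (R : comNzRingType) (V : vertex_model R).
Let C := color V.

Definition code_matrix (G : gauss_code) : kernel R C :=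
  word_matrix V (fun c => Classical (sign c)) (code G).

Lemma full_add_kink u s G : full G -> full (add_kink u s G).
Proof.
case=> U M; split.
  rewrite cat_uniq map_inj_uniq; last by move=> [x t] [x' t'] [-> ->].
  rewrite U andbT /= inE xpair_eqE eqxx /=.
  rewrite andbT; apply/andP; split; first by case: (s).
  by apply/hasPn => -[y t] /mapP[p _ [-> _]]; rewrite !inE.
move=> [[x|] t]; rewrite mem_cat.
  by rewrite (map_f (fun p => (Some p.1, p.2)) (M (x, t))) orbT.
by rewrite !inE !xpair_eqE eqxx; case: s t => [] [].
Qed.

Lemma code_matrix_add_kink u s G : full G ->
  code_matrix (add_kink u s G) = kmul (kink V u s) (code_matrix G).
Proof.
case=> U M.
have := @word_matrix_R1 R V (node G) (option (node G))
  (fun c => Classical (sign c))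
  (fun c => Classical (if c is Some x then sign x else u)) Some.
move=> /(_ _ _ None _ _ [::] (code G) s) /= E; rewrite {1}/code_matrix /= E //.
- by move=> x y [].
- by move=> [x|] //; rewrite codom_f.
Qed.

Lemma prod_bool (X : finType) (l : seq X) (P : pred X) :
  \prod_(y <- l) (P y)%:R = (all P l)%:R :> R.
Proof.
elim: l => [|y l IH]; first by rewrite big_nil.
by rewrite big_cons IH /= -natrM mulnb.
Qed.

Lemma chain_classical (K : long_diagram) (g : crossing K -> bead V) :
  chain (@kind K) g (passages K) =
  chain (fun c : node (classical_code K) => Classical (sign c)) (fun c => g (val c))
    (code (classical_code K)).
Proof.
rewrite /= /classical_passages /=.
elim: (passages K) => //= -[c s] w IH /=.
case: insubP => /= [c' kc cc'|kc].
  congr (kmul _ _); last exact: IH.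
  by rewrite /segment /= kc cc'.
by rewrite /segment /= (negbTE kc) kmul1k.
Qed.

(** A virtual crossing contributes a factor which forces its bead to be [bead0] and no
    segment, so the sum is over the beads of the classical crossings only. *)
Lemma diagram_matrix_classical (K : long_diagram) :
  diagram_matrix V K = code_matrix (classical_code K).
Proof.
apply: functional_extensionality => a; apply: functional_extensionality => b.
rewrite /diagram_matrix /code_matrix /word_matrix.
pose f (c : node (classical_code K)) : crossing K := val c.
pose new := enum [pred c : crossing K | ~~ is_classical (kind c)].
have fnew x : f x \notin new by rewrite mem_enum inE negbK (valP x).
have cov y : (y \in new) || (y \in codom f).
  rewrite mem_enum inE; case: (boolP (is_classical (kind y))) => //= ky.
  by apply/codomP; exists (Sub y ky); rewrite /f SubK.
rewrite -[RHS](@sum_embedding _ _ f new val_inj fnew cov R _ (bead0 V)).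
rewrite [RHS]big_mkcond; apply: eq_bigr => g _ /=.
rewrite (prod_embedding (f := f) (new := new)) ?enum_uniq //; last exact: val_inj.
transitivity ((all (fun y => g y == bead0 V) new)%:R *
  (\prod_x kind_weight (kind (f x)) (g (f x)) * chain (@kind K) g (passages K) a b)).
  rewrite mulrA; congr (_ * _ * _); rewrite -prod_bool big_seq [RHS]big_seq.
  by apply: eq_bigr => y; rewrite mem_enum inE; case: (kind y).
case: ifP => _; last by rewrite mul0r.
rewrite mul1r chain_classical; congr (_ * _).
  apply: eq_bigr => x _; rewrite ffunE /f.
  by have := valP x; case: (kind (val x)).
by congr (_ a b); apply: eq_chain => p _; rewrite ffunE.
Qed.

(** The edge after passage [p] is named [p], and [prv p] is the edge before it. *)
Definition closed_sum (X : finType) (u : X -> bool) (prv : X * bool -> X * bool) : R :=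
  \sum_(e : {ffun X * bool -> C}) \prod_c
    weight V (u c) (e (prv (c, false))) (e (c, false))
                   (e (prv (c, true))) (e (c, true)).

Lemma chain_path (G : gauss_code) (g : node G -> bead V) p w a b :
  chain (fun c => Classical (sign c)) g (p :: w) a b =
  (a == (pass (g p.1) p.2).1)%:R *
  (path (fun p q => (pass (g p.1) p.2).2 == (pass (g q.1) q.2).1) p w)%:R *
  ((pass (g (last p w).1) (last p w).2).2 == b)%:R.
Proof.
elim: w p a => [|q w IH] p a.
  by rewrite /= kmulk1 /segment /= /unit_kernel mulr1.
transitivity (\sum_x segment (fun c => Classical (sign c)) g p a x *
  chain (fun c => Classical (sign c)) g (q :: w) x b); first by [].
under eq_bigr => x _ do rewrite IH.
rewrite /segment /= /unit_kernel.
under eq_bigr => x _ do rewrite -!mulrA.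
rewrite -mulr_sumr -!mulrA; congr (_ * _).
by rewrite sum_deltal -mulnb natrM !mulrA.
Qed.

(** A family of beads contributes to the trace exactly if it comes from a colouring of
    the edges of the closed curve. *)
Lemma trace_code_matrix (G : gauss_code) : full G -> code G != [::] ->
  \sum_a code_matrix G a a = closed_sum (@sign G) (prev (code G)).
Proof.
case=> U M G0.
pose out (g : {ffun node G -> bead V}) p := (pass (g p.1) p.2).2.
pose inn (g : {ffun node G -> bead V}) p := (pass (g p.1) p.2).1.
have tr (g : {ffun node G -> bead V}) :
    \sum_a chain (fun c => Classical (sign c)) g (code G) a a =
    [forall p, inn g p == out g (prev (code G) p)]%:R :> R.
  transitivity ((cycle (fun p q => out g p == inn g q) (code G))%:R : R).
    case: (code G) G0 => // p w _; under eq_bigr => a _ do rewrite chain_path eq_sym.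
    under eq_bigr => a _ do rewrite -mulrA.
    by rewrite sum_deltal /= rcons_path -mulnb natrM /out /inn.
  congr (nat_of_bool _)%:R; apply/idP/forallP => [cyc p|H].
    by rewrite eq_sym; apply: (prev_cycle cyc); exact: M.
  by apply: cycle_from_prev => // p _; rewrite eq_sym.
rewrite /code_matrix /word_matrix exchange_big /=.
under eq_bigr => g _ do rewrite -mulr_sumr tr.
pose h (e : {ffun node G * bool -> C}) : {ffun node G -> bead V} :=
  [ffun c => ((e (prev (code G) (c, false)), e (c, false)),
              (e (prev (code G) (c, true)), e (c, true)))].
have hout e p : out (h e) p = e p by case: p => c []; rewrite /out ffunE.
have hin e p : inn (h e) p = e (prev (code G) p).
  by case: p => c []; rewrite /inn ffunE.
transitivity (\sum_(g : {ffun node G -> bead V} |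
    [forall p, inn g p == out g (prev (code G) p)])
   \prod_c kind_weight (Classical (sign c)) (g c)).
  by rewrite [RHS]big_mkcond; apply: eq_bigr => g _; case: ifP; rewrite ?mulr1 ?mulr0.
rewrite (reindex_onto h (fun g => [ffun p => out g p])) /=.
  apply: eq_big => [e|e _].
    apply/andP; split.
      by apply/forallP => p; rewrite hout hin.
    by apply/eqP/ffunP => p; rewrite ffunE hout.
  by apply: eq_bigr => c _; rewrite ffunE.
move=> g /forallP H; apply/ffunP => c; rewrite !ffunE.
move: (H (c, false)) (H (c, true)); rewrite /inn /out /= => /eqP <- /eqP <-.
by case: (g c) => -[? ?] [].
Qed.

End Matrix.

Arguments code_matrix {R} V G.

(** * The two-cable of a closed diagram *)

Section CableDiagram.
Variables (X : finType) (u : X -> bool) (prv : X * bool -> X * bool).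

(** The small crossing [(c, i, j)] is that of lane [i] of strand [false] with lane [j] of
    strand [true] of [c]. *)
Definition cable_node : finType := (X * bool * bool)%type.
Definition cable_sign (c : cable_node) : bool := u c.1.1.

(** The last small passage of lane [l] after passage [p] of the original diagram. *)
Definition exit_of (p : X * bool) (l : bool) : cable_node * bool :=
  if p.2 then ((p.1, false, l), true) else ((p.1, l, true), false).

(** Lane [i] of strand [false] passes [j = false], then [j = true]; lane [j] of strand
    [true] passes [i = true], then [i = false]. *)
Definition cable_prev (p : cable_node * bool) : cable_node * bool :=
  let: ((c, i, j), s) := p in
  if s then (if i then exit_of (prv (c, true)) j else ((c, true, j), true))
  else (if j then ((c, i, false), false) else exit_of (prv (c, false)) i).

Lemma exit_of_inj p l p' l' : exit_of p l = exit_of p' l' -> p = p' /\ l = l'.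
Proof. by move: p p' => [c []] [c' []] //= [-> ->]. Qed.

Definition is_exit (p : cable_node * bool) : bool :=
  let: ((c, i, j), s) := p in if s then ~~ i else j.

Lemma is_exit_exit_of p l : is_exit (exit_of p l).
Proof. by case: p => c []. Qed.

Lemma cable_prev_inj : injective prv -> injective cable_prev.
Proof.
move=> inj.
have exitE q : is_exit (cable_prev q) = if q.2 then q.1.1.2 else ~~ q.1.2.
  by move: q => [[[c []] []] []] //=; rewrite is_exit_exit_of.
move=> q q' E; have := exitE q; rewrite E exitE.
move: q q' E => [[[c i] j] s] [[[c' i'] j'] s'] /=.
case: s; case: s'; case: i; case: i'; case: j; case: j' => //= E _;
  try by case: E => *; congruence.
all: by have [/inj[->] //] := exit_of_inj E.
Qed.

Section Sum.
Variables (R : comNzRingType) (V : vertex_model R).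
Let C := color V.

Definition lane (p : C * C) (l : bool) := if l then p.2 else p.1.

(** [h.1] and [h.2] are the colours of the four inner edges of the square of small
    crossings. *)
Lemma two_cable_weightE (T : tensor R C C) a b c d :
  two_cable false true T a b c d = \sum_(h : (C * C) * (C * C))
    T a.2 h.1.2 c.1 h.2.1 * T a.1 h.1.1 h.2.1 d.1 *
    (T h.1.2 b.2 c.2 h.2.2 * T h.1.1 b.1 h.2.2 d.2).
Proof.
rewrite [RHS]sum_pair; apply: eq_bigr => x _.
by rewrite /swap_arcs /fuse sum_mul2 [RHS]sum_pair.
Qed.

Lemma prod_cable (F : cable_node -> R) :
  \prod_q F q = \prod_c (F (c, true, false) * F (c, false, false) *
                        (F (c, true, true) * F (c, false, true))).
Proof.
have prod_pair (A B : finType) (G : A * B -> R) : \prod_x G x = \prod_a \prod_b G (a, b).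
  by rewrite pair_bigA; apply: eq_bigr; case.
rewrite prod_pair prod_pair; apply: eq_bigr => c _; rewrite !big_bool /=; ring.
Qed.

(** A colouring of the cable is a colouring of the edges by pairs together with the
    colours of the inner edges at all crossings. *)
Lemma closed_sum_cable :
  closed_sum (two_cable_model V) u prv = closed_sum V cable_sign cable_prev.
Proof.
rewrite /closed_sum /=.
under eq_bigr => e _ do (under eq_bigr => c _ do rewrite two_cable_weightE;
  rewrite bigA_distr_bigA).
rewrite pair_bigA /=.
pose dec (p : {ffun X * bool -> C * C} * {ffun X -> (C * C) * (C * C)}) :
    {ffun cable_node * bool -> C} := [ffun q : cable_node * bool =>
  let: ((c, i, j), s) := q in
  if s then (if i then lane (p.2 c).2 j else lane (p.1 (c, true)) j)
  else (if j then lane (p.1 (c, false)) i else lane (p.2 c).1 i)].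
pose enc (e : {ffun cable_node * bool -> C}) :
    {ffun X * bool -> C * C} * {ffun X -> (C * C) * (C * C)} :=
  ([ffun p => (e (exit_of p false), e (exit_of p true))],
   [ffun c => ((e ((c, false, false), false), e ((c, true, false), false)),
               (e ((c, true, false), true), e ((c, true, true), true)))]).
have encK : cancel dec enc.
  move=> [e h]; rewrite /enc; congr (_, _); apply/ffunP => x; rewrite !ffunE /=.
    by case: x => x [] /=; rewrite ?ffunE /=; case: (e _).
  by case: (h x) => [[? ?] []].
have decK : cancel enc dec.
  move=> e; apply/ffunP => -[[[c i] j] s]; rewrite ffunE /enc /= !ffunE.
  by case: s; case: i; case: j.
have dec_exit p q l : dec p (exit_of q l) = lane (p.1 q) l.
  by rewrite ffunE /exit_of; case: q => c [] /=.
rewrite [RHS](reindex dec) /=; last by exists enc => ? _; [exact: encK|exact: decK].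
apply: eq_bigr => p _.
rewrite prod_cable; apply: eq_bigr => c _.
by rewrite /cable_sign /= !dec_exit /dec !ffunE.
Qed.

End Sum.
End CableDiagram.

(** * Bounds for the entries of cabled weights *)

Section Norm.
Variable R : realFieldType.

(** A bound for the operator norm with respect to the l2 norm.  It is multiplicative
    under fusion, whereas a bound for the entries would pick up the number of
    colours at each inner edge. *)
Definition norm_le A B (l : R) (T : tensor R A B) : Prop :=
  0 <= l /\ forall phi, \sum_a \sum_b act T phi a b ^+ 2 <=
    l ^+ 2 * \sum_a \sum_b phi a b ^+ 2.

Lemma norm_le_lane1 A B l (T : tensor R A B) phi : norm_le l T ->
  \sum_a \sum_b lane1 T phi a b ^+ 2 <= l ^+ 2 * \sum_a \sum_b phi a b ^+ 2.
Proof.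
case=> _ H; rewrite !sum_pair exchange_big [X in _ <= _ * X]exchange_big /=.
rewrite mulr_sumr; apply: ler_sum => a2 _.
exact: (H (fun x => phi (x, a2))).
Qed.

Lemma norm_le_lane2 A B l (T : tensor R A B) phi : norm_le l T ->
  \sum_a \sum_b lane2 T phi a b ^+ 2 <= l ^+ 2 * \sum_a \sum_b phi a b ^+ 2.
Proof.
case=> _ H; rewrite !sum_pair /= mulr_sumr; apply: ler_sum => a1 _.
exact: (H (fun x => phi (a1, x))).
Qed.

Lemma norm_le_fuse o A B l (T : tensor R A B) :
  norm_le l T -> norm_le (l ^+ 2) (fuse o T).
Proof.
move=> H; have l0 := H.1; split=> [|phi]; first exact: exprn_ge0.
rewrite act_fuse exprS expr1 mulrAC -mulrA [_ * l ^+ 2]mulrC.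
case: o.
  apply: le_trans (norm_le_lane2 _ H) _.
  by rewrite ler_wpM2l ?sqr_ge0 //; exact: norm_le_lane1.
apply: le_trans (norm_le_lane1 _ H) _.
by rewrite ler_wpM2l ?sqr_ge0 //; exact: norm_le_lane2.
Qed.

Lemma norm_le_swap A B l (T : tensor R A B) :
  norm_le l T -> norm_le l (swap_arcs T).
Proof.
case=> l0 H; split=> // phi; rewrite exchange_big [X in _ <= _ * X]exchange_big /=.
apply: le_trans (H (fun a b => phi b a)); rewrite le_eqVlt; apply/orP; left.
apply/eqP; apply: eq_bigr => a _; apply: eq_bigr => b _; congr (_ ^+ 2).
by rewrite /act exchange_big.
Qed.

Lemma norm_le_two_cable o1 o2 A B l (T : tensor R A B) :
  norm_le l T -> norm_le (l ^+ 4) (two_cable o1 o2 T).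
Proof.
move=> H; rewrite -[4%N]/(2 * 2)%N exprM; apply: norm_le_swap.
by apply: norm_le_fuse; apply: norm_le_swap; exact: norm_le_fuse.
Qed.

Lemma entry_le A B l (T : tensor R A B) a b c d :
  norm_le l T -> `|T a b c d| <= l.
Proof.
case=> l0 H; rewrite -(ler_pXn2r (n := 2)) ?nnegrE // real_normK ?num_real //.
have := H (fun x y => (x == b)%:R * (y == d)%:R).
have -> : \sum_x \sum_y ((x == b)%:R * (y == d)%:R : R) ^+ 2 = 1.
  have E x y : ((x == b)%:R * (y == d)%:R : R) ^+ 2 = (x == b)%:R * ((y == d)%:R * 1).
    by case: (x == b); case: (y == d); rewrite ?(mul0r, mulr0, mul1r, mulr1, expr0n, expr1n).
  under eq_bigr => x _ do (under eq_bigr => y _ do rewrite E; rewrite -mulr_sumr).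
  by under eq_bigr => x _ do rewrite sum_deltal_sym; rewrite sum_deltal_sym.
rewrite mulr1; apply: le_trans.
have -> : T a b c d = act T (fun x y => (x == b)%:R * (y == d)%:R) a c.
  rewrite /act; under eq_bigr => x _ do
    (under eq_bigr => y _ do rewrite mulrA; rewrite sum_deltar).
  by rewrite sum_deltar.
rewrite (bigD1 a) //= (bigD1 c) //= -addrA lerDl.
by rewrite addr_ge0 ?sumr_ge0 // => ? _; rewrite ?sumr_ge0 // => *; exact: sqr_ge0.
Qed.

Section Base.
Variables (C : finType) (q : R).
Hypotheses (q1 : 1 <= q) (qC : q + q^-1 = #|C|%:R).

(** Q / N is an orthogonal projection commuting with the isometry P, and P - q^-1 Q
    has the eigenvalue - q^-2 on its image. *)
Lemma norm_le_light : norm_le 1 (crossing_tensor q^-1 : tensor R C C).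
Proof.
split=> // phi; rewrite expr1n mul1r act_crossing.
set S := \sum_y phi y y.
have E a b : (phi b a - q^-1 * ((a == b)%:R * S)) ^+ 2 =
   phi b a ^+ 2 - 2 * q^-1 * S * ((a == b)%:R * phi b a) + q^-1 ^+ 2 * S ^+ 2 * ((a == b)%:R * 1).
  by case: (a == b); rewrite /=; ring.
under eq_bigr => a _ do under eq_bigr => b _ do rewrite E.
under eq_bigr => a _ do rewrite big_split sumrB -!mulr_sumr !sum_deltal.
rewrite /= big_split sumrB -!mulr_sumr -/S /= exchange_big /=.
rewrite sumr_const -/(1 *+ #|C|) -qC.
rewrite -addrA gerDl.
have q0 : q != 0 by rewrite gt_eqF // (lt_le_trans ltr01).
have -> : - (2 * q^-1 * S * S) + q^-1 ^+ 2 * S ^+ 2 * (q + q^-1) =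
    - ((q^-1 * S) ^+ 2 * (q - q^-1)) by field.
rewrite oppr_le0 mulr_ge0 ?sqr_ge0 // subr_ge0.
by apply: le_trans q1; rewrite invf_le1 // (lt_le_trans ltr01).
Qed.

Lemma norm_le_scale A B l k (T : tensor R A B) : norm_le l T ->
  norm_le (`|k| * l) (fun a b c d => k * T a b c d).
Proof.
case=> l0 H; split=> [|phi]; first by rewrite mulr_ge0.
have E a b : act (fun a b c d => k * T a b c d) phi a b = k * act T phi a b.
  rewrite /act mulr_sumr; apply: eq_bigr => x _; rewrite mulr_sumr.
  by apply: eq_bigr => y _; rewrite mulrA.
under eq_bigr => a _ do (under eq_bigr => b _ do rewrite E exprMn;
  rewrite -mulr_sumr).
rewrite -mulr_sumr exprMn real_normK ?num_real // -[leRHS]mulrA.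
by apply: ler_wpM2l; [exact: sqr_ge0 | exact: H].
Qed.

(** After reversal of one strand, a heavy crossing is - q times a light one. *)
Lemma norm_le_heavy : norm_le q (reverse2 (crossing_tensor q : tensor R C C)).
Proof.
have q0 : 0 < q by rewrite (lt_le_trans ltr01).
have := norm_le_scale (- q) norm_le_light.
rewrite mulr1 normrN gtr0_norm //; congr (norm_le _ _).
do 4!(apply: functional_extensionality => ?).
by rewrite /reverse2 /crossing_tensor; field; rewrite gt_eqF.
Qed.

End Base.

End Norm.

(** * Adequacy and its inheritance by cables *)

(** Edges are named by the passage before them, as in [closed_sum]. *)
Record closed_diagram := ClosedDiagram {
  vert : finType;
  vsign : vert -> bool;
  prior : vert * bool -> vert * bool
}.

Definition cable (G : closed_diagram) : closed_diagram :=
  ClosedDiagram (cable_sign (@vsign G)) (cable_prev (@prior G)).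

Section Adequacy.
Variable u0 : bool.

(** [g] is constant on the arcs of the state which has the smoothing P at light and Q at
    heavy crossings. *)
Definition joined (T : eqType) (G : closed_diagram) (g : vert G * bool -> T) : Prop :=
  forall c, if vsign c == u0
    then g (prior (c, false)) = g (c, true) /\ g (prior (c, true)) = g (c, false)
    else g (prior (c, false)) = g (prior (c, true)) /\ g (c, false) = g (c, true).

(** The two arcs of the state at [c] lie on different loops: a colouring of the loops
    separates them. *)
Definition adequate (G : closed_diagram) : Prop :=
  forall c : vert G, exists2 g : vert G * bool -> bool,
    joined g & g (prior (c, false)) != g (c, false).

(** [o] compares the direction of each edge with a direction of its state loop: the
    smoothing P respects the directions of the strands, Q reverses them. *)
Definition orientation (G : closed_diagram) (o : vert G * bool -> bool) : Prop :=
  forall c, if vsign c == u0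
    then o (prior (c, false)) = o (c, true) /\ o (prior (c, true)) = o (c, false)
    else o (prior (c, false)) = ~~ o (prior (c, true)) /\ o (c, false) = ~~ o (c, true).

Definition heavy_number (G : closed_diagram) := #|[pred c : vert G | vsign c != u0]|.

Section Cable.
Variable G : closed_diagram.

(** The values on the four inner edges at each crossing are forced by those on the lanes
    of the outer edges, if all arcs of the state of the cable have to be
    monochromatic. *)
Definition lift_lanes (F : vert G * bool -> bool -> bool) (q : vert (cable G) * bool) : bool :=
  let: ((c, i, j), s) := q in
  if s then (if i then
               (if vsign c == u0 then
                  (if j then F (prior (c, true)) false else F (prior (c, false)) true)
                else (if j then F (c, true) false else F (prior (c, false)) false))
             else F (c, true) j)
  else (if j then F (c, false) i else
          (if vsign c == u0 then
             (if i then F (prior (c, true)) false else F (prior (c, false)) true)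
           else (if i then F (prior (c, false)) false else F (c, true) false))).

Lemma lift_lanes_exit F p l : lift_lanes F (exit_of p l) = F p l.
Proof. by case: p => c []. Qed.

Lemma lift_lanes_joined F :
  (forall c l, if vsign c == u0
    then F (prior (c, false)) l = F (c, true) l /\
         F (prior (c, true)) l = F (c, false) l
    else F (prior (c, false)) l = F (prior (c, true)) (~~ l) /\
         F (c, false) l = F (c, true) (~~ l)) ->
  joined (lift_lanes F).
Proof.
move=> H [[c i] j]; have := H c true; have := H c false.
rewrite /= /cable_sign /=; case: i; case: j; case: ifP => E [h1 h2] [h3 h4];
  rewrite /= ?lift_lanes_exit ?E ?h1 ?h2 ?h3 ?h4 //=.
Qed.

(** The state loops of the cable are pairs of parallel copies of those of the diagram.
    At two of the four small crossings, the arcs belong to copies of the two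
    different arcs at the original crossing, and a separating colouring of the
    original lifts.  At the other two they are the two parallel copies of one
    arc; these are distinguished as left and right with respect to an
    orientation of the loop. *)
Lemma cable_adequate (o : vert G * bool -> bool) : orientation o -> adequate G -> adequate (cable G).
Proof.
move=> ho ad [[c i] j].
have [g gj gc] := ad c.
pose F1 p (l : bool) := g p.
pose F2 p (l : bool) := o p (+) l.
have j1 : joined (lift_lanes F1).
  by apply: lift_lanes_joined => c' l; exact: gj.
have j2 : joined (lift_lanes F2).
  apply: lift_lanes_joined => c' l; rewrite /F2; have := ho c'.
  by case: ifP => _ [-> ->]; split=> //; rewrite addNb addbN.
have gjc := gj c; have hoc := ho c.
have [cu|cu] := boolP (vsign c == u0); rewrite ?cu ?(negbTE cu) in gjc hoc;
  case: gjc => g1 g2; case: hoc => o1 o2.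
  (* Smoothing P: the two arcs are parallel copies on the diagonal. *)
  have [ij|ij] := eqVneq i j.
    exists (lift_lanes F2) => //.
    by rewrite -ij; case: i {ij} => /=; rewrite ?lift_lanes_exit /F2 cu ?o1 ?o2;
      case: (o _).
  exists (lift_lanes F1) => //.
  by move: ij; case: i; case: j => //= _; rewrite ?lift_lanes_exit /F1 cu ?g2.
(* Smoothing Q: the two arcs are parallel copies off the diagonal. *)
have [ij|ij] := eqVneq i j.
  exists (lift_lanes F1) => //.
  rewrite -ij; case: i {ij} => /=; rewrite ?lift_lanes_exit /F1 (negbTE cu) //.
  by rewrite -g2.
exists (lift_lanes F2) => //.
by move: ij; case: i; case: j => //= _; rewrite ?lift_lanes_exit /F2 (negbTE cu) ?o1 ?o2;
  case: (o _).
Qed.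

Lemma heavy_number_cable : heavy_number (cable G) = (4 * heavy_number G)%N.
Proof.
rewrite /heavy_number.
transitivity #|[predX [predX [pred c : vert G | vsign c != u0] & {: bool}] & {: bool}]|.
  by apply: eq_card => c; rewrite !inE !andbT.
by rewrite !cardX !card_bool -mulnA mulnC.
Qed.

End Cable.
End Adequacy.

Local Close Scope ring_scope.

(** * Counting colourings *)

Section Count.
Variables (V : finType) (n : nat).
Let C : finType := 'I_n.+1.

Definition solution (L : seq (V * V)) (T : eqType) (e : V -> T) : bool :=
  all (fun p => e p.1 == e p.2) L.

Definition count_solutions (L : seq (V * V)) : nat :=
  #|[pred e : {ffun V -> C} | solution L e]|.

Lemma solution_map (S T : eqType) (f : S -> T) (e : V -> S) L :
  solution L e -> solution L (fun v => f (e v)).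
Proof. by apply: sub_all => p /eqP ->. Qed.

(** Adding multiples of the indicator of [g] changes the difference of the colours of
    [x] and [y] arbitrarily, so this difference is equidistributed on the
    solutions. *)
Lemma count_separated L x y (g : V -> bool) :
  solution L g -> g x != g y ->
  count_solutions L = (n.+1 * count_solutions ((x, y) :: L))%N.
Proof.
wlog gx : g / g x.
  move=> W gL gxy; case: (boolP (g x)) => gx; first exact: (W g).
  apply: (W (fun v => ~~ g v)) => //; first exact: (solution_map negb gL).
  by move: gxy; case: (g x); case: (g y).
move=> gL; rewrite gx => gxy; have {gxy} gy : g y = false by case: (g y) gxy.
pose A := [predX {: C} & [pred e : {ffun V -> C} | solution ((x, y) :: L) e]].
pose f (p : C * {ffun V -> C}) : {ffun V -> C} :=
  [ffun v => (p.2 v + (if g v then p.1 else 0))%R].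
have -> : (n.+1 * count_solutions ((x, y) :: L))%N = #|A|.
  by rewrite cardX card_ord.
have f_inj : {in A &, injective f}.
  move=> [t k] [t' k']; rewrite !inE /= => /andP[/eqP kxy _] /andP[/eqP kxy' _] /ffunP E.
  have Ev v : (k v + (if g v then t else 0) = k' v + (if g v then t' else 0))%R.
    by have := E v; rewrite !ffunE.
  have kx : k x = k' x.
    by rewrite kxy kxy'; have := Ev y; rewrite gy !addr0.
  have tt : t = t' by have := Ev x; rewrite gx kx => /addrI.
  congr (_, _) => //; apply/ffunP => v; have := Ev v; rewrite tt; exact: addIr.
rewrite -(card_in_image f_inj); apply: eq_card => e.
rewrite inE; apply/idP/imageP => [eL|[[t k]]].
  pose t := (e x - e y)%R.
  exists (t, [ffun v => e v - (if g v then t else 0)]%R); last first.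
    by apply/ffunP => v; rewrite !ffunE /= subrK.
  rewrite !inE /= !ffunE gx gy subr0 /t subKr eqxx /=.
  apply/allP => -[a b] ab; have /allP/(_ _ ab)/eqP /= eab := eL.
  by have /allP/(_ _ ab)/eqP /= gab := gL; rewrite !ffunE eab gab.
rewrite !inE /= => /andP[_ kL] ->.
apply/allP => -[a b] ab; have /allP/(_ _ ab)/eqP /= kab := kL.
by have /allP/(_ _ ab)/eqP /= gab := gL; rewrite !ffunE /= kab gab.
Qed.

(** If some solution separates [x] from [y], then the indicator of one of its colours is
    a colouring as in [count_separated]; otherwise the new equation is
    redundant. *)
Lemma count_le L x y :
  (count_solutions L <= n.+1 * count_solutions ((x, y) :: L))%N.
Proof.
case: (boolP [exists e : {ffun V -> C}, solution L e && (e x != e y)]).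
  case/existsP => e /andP[eL exy].
  rewrite (@count_separated L x y (fun v => e v == e x)) //.
    exact: (solution_map (fun c => c == e x) eL).
  by rewrite eqxx eq_sym; move: exy; rewrite eq_sym; case: (e y == e x).
move=> /existsPn H; apply: leq_trans (leq_pmull _ _) => //.
apply: subset_leq_card; apply/subsetP => e; rewrite !inE => eL /=.
have := H e; rewrite negb_and negbK; move: (eL); rewrite /solution /= => ->.
by rewrite /= => ->.
Qed.

Lemma count_sub L L' :
  (forall e : {ffun V -> C}, solution L e -> solution L' e) ->
  (count_solutions L <= count_solutions L')%N.
Proof. by move=> H; apply: subset_leq_card; apply/subsetP => e; exact: H. Qed.

End Count.

(** * Changing one smoothing *)

Section States.
Variables (u0 : bool) (G : closed_diagram) (n : nat).
Hypothesis prior_inj : injective (@prior G).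
Let E : finType := (vert G * bool)%type.
Let C : finType := 'I_n.+1.

Definition smoothing (b : bool) (c : vert G) : seq (E * E) :=
  if b then [:: (prior (c, false), (c, true)); ((c, false), prior (c, true))]
  else [:: (prior (c, false), prior (c, true)); ((c, false), (c, true))].

Definition state_away (st : vert G -> bool) (c : vert G) : seq (E * E) :=
  flatten [seq smoothing (st d) d | d <- enum (vert G) & d != c].

Definition consistent (T : eqType) (st : vert G -> bool) (e : E -> T) : bool :=
  [forall c, solution (smoothing (st c) c) e].

Definition state_count (st : vert G -> bool) : nat :=
  #|[pred e : {ffun E -> C} | consistent st e]|.

Lemma solution_cat (L L' : seq (E * E)) (T : eqType) (e : E -> T) :
  solution (L ++ L') e = solution L e && solution L' e.
Proof. exact: all_cat. Qed.

Lemma solution_away (T : eqType) st c (e : E -> T) :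
  reflect (forall d, d != c -> solution (smoothing (st d) d) e)
    (solution (state_away st c) e).
Proof.
have all_flatten (P : pred (E * E)) ss : all P (flatten ss) = all (all P) ss.
  by elim: ss => //= l ss IH; rewrite all_cat IH.
rewrite /solution /state_away all_flatten all_map.
apply: (iffP allP) => H d.
  by move=> dc; apply: H; rewrite mem_filter dc mem_enum.
by rewrite mem_filter => /andP[dc _]; exact: H.
Qed.

Lemma state_countE st c :
  state_count st = count_solutions n (smoothing (st c) c ++ state_away st c).
Proof.
apply: eq_card => e; rewrite !inE solution_cat; apply/forallP/andP => [H|[Hc H] d].
  by split; [exact: H | apply/solution_away => d _; exact: H].
by have [->|dc] := eqVneq d c => //; move/solution_away: H; apply.
Qed.

Lemma eq_state_away st st' c : (forall d, d != c -> st d = st' d) ->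
  state_away st c = state_away st' c.
Proof.
move=> H; rewrite /state_away; congr flatten; apply/eq_in_map => d.
by rewrite mem_filter => /andP[/H -> _].
Qed.

(** Joining all four ends at [c] costs at most one loop, and implies both smoothings. *)
Lemma state_count_flip st st' c : (forall d, d != c -> st d = st' d) ->
  (state_count st <= n.+1 * state_count st')%N.
Proof.
move=> stE; rewrite !(state_countE _ c) (eq_state_away stE).
apply: leq_trans (count_le n _ (prior (c, false)) (c, false)) _.
rewrite leq_mul2l /=; apply: count_sub => e; rewrite -cat_cons !solution_cat.
case/andP => H ->; rewrite andbT; move: H.
by case: (st c); case: (st' c);
  rewrite /solution /= !andbT => /and3P[/eqP -> /eqP -> /eqP ->]; rewrite !eqxx.
Qed.

(** Count the ends of edges with value [true]: the total is even, and so is the number at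
    each crossing other than [c]. *)
Lemma parity (c : vert G) st (h : E -> bool) : solution (state_away st c) h ->
  h (prior (c, false)) (+) h (c, false) (+) h (prior (c, true)) (+) h (c, true) =
  false.
Proof.
move=> /solution_away H.
pose s d := (h (prior (d, false)) + h (d, false) + h (prior (d, true)) + h (d, true))%N.
have total : \sum_d s d = ((\sum_p h p) * 2)%N.
  have pair_sum (F : E -> nat) : \sum_p F p = \sum_d (F (d, false) + F (d, true))%N.
    rewrite (eq_bigr (fun p => F (p.1, p.2))); last by case.
    rewrite -(pair_bigA _ (fun d b => F (d, b))) /=; apply: eq_bigr => d _.
    by rewrite big_bool addnC.
  rewrite muln2 -addnn {1}(reindex_inj prior_inj) /= !pair_sum -big_split /=.
  by apply: eq_bigr => d _; rewrite /s; lia.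
have even_away d : d != c -> ~~ odd (s d).
  move=> /H; rewrite /s; case: (st d); rewrite /solution /= andbT => /andP[/eqP -> /eqP ->].
    by rewrite !oddD; case: (h _); case: (h _).
  by rewrite !oddD; case: (h _); case: (h _).
have : ~~ odd (s c).
  have : ~~ odd (\sum_d s d) by rewrite total muln2 odd_double.
  rewrite (bigD1 c) //= oddD.
  have -> : odd (\sum_(d | d != c) s d) = false; last by rewrite addbF.
  by apply: (big_ind (fun m => odd m = false)) => // [a b oa ob|d /even_away/negbTE //];
    rewrite oddD oa ob.
by rewrite /s !oddD; do 4!case: (h _).
Qed.

Definition base_state (c : vert G) : bool := vsign c == u0.

Lemma joinedP (g : E -> bool) : joined u0 g -> consistent base_state g.
Proof.
move=> H; apply/forallP => c; have := H c; rewrite /base_state /smoothing.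
by case: ifP => _ [g1 g2]; rewrite /solution /= g1 g2 !eqxx.
Qed.

(** By adequacy the state loses a loop if all ends at [c] are joined.  The claim is that
    the other smoothing joins them all, i.e. that the arcs away from [c] already
    connect the ends of each original arc at [c].  If they did not, then a
    colouring separating these two ends, cut down to one of the loops through
    [c], would violate [parity]. *)
Lemma adequate_flip st c : adequate u0 G -> (forall d, d != c -> st d = base_state d) ->
  st c = ~~ base_state c -> (n.+1 * state_count st <= state_count base_state)%N.
Proof.
move=> ad stE stc; have [g /joinedP/forallP gj gc] := ad c.
have away : solution (state_away base_state c) g by apply/solution_away => d _.
rewrite !(state_countE _ c) (eq_state_away stE) stc.
rewrite (@count_separated _ n (smoothing (base_state c) c ++ _)
  (prior (c, false)) (c, false) g) //; last by rewrite solution_cat gj away.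
rewrite leq_mul2l /=; apply: count_sub => e.
rewrite -cat_cons !solution_cat => /andP[ec ea]; rewrite ea andbT.
wlog gx : g gj gc away / g (prior (c, false)).
  move=> W; case: (boolP (g (prior (c, false)))) => gx; first exact: (W g).
  apply: (W (fun v => ~~ g v)) => //.
  - by move=> d; apply: (solution_map negb (gj d)).
  - by move: gc; do 2!case: (g _).
  - exact: (solution_map negb away).
have {gc} gy : g (c, false) = false by move: gc; rewrite gx; case: (g _).
(* The colouring which violates parity unless the claim holds. *)
pose h v := (e v == e (prior (c, false))) && g v.
have hp : solution (state_away base_state c) h.
  apply/solution_away => d dc; apply/allP => -[a b] ab.
  have /solution_away/(_ d dc)/allP/(_ _ ab)/eqP /= eab := ea.
  have /solution_away/(_ d dc)/allP/(_ _ ab)/eqP /= gab := away.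
  by rewrite /h eab gab.
have := parity hp; rewrite /h eqxx gx gy andbF /=.
have := gj c; move: ec; rewrite /solution; case: (base_state c) => /=;
  rewrite ?andbT => /andP[/eqP e1 /eqP e2] /andP[/eqP g1 /eqP g2].
  rewrite -g2 gy andbF -g1 gx andbT e2 eq_sym => /negbFE/eqP <-.
  by rewrite e1 !eqxx.
rewrite -g2 gy andbF -g1 gx andbT !addbF => /negbFE/eqP e3.
by rewrite -e1 e2 e3 !eqxx.
Qed.

End States.

Local Open Scope ring_scope.

(** * The lower bound for adequate diagrams *)

Section LowerBound.
Variables (R : realFieldType) (n : nat) (q : R) (u0 : bool).
Hypotheses (q1 : 1 <= q) (qn : q + q^-1 = n.+1%:R).
Let C : finType := 'I_n.+1.

(** The two values of t in P - t Q, at light and at heavy crossings. *)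
Definition bracket_root (u : bool) : R := if u == u0 then q^-1 else q.

Let q_gt0 : 0 < q. Proof. exact: lt_le_trans ltr01 q1. Qed.
Let q_neq0 : q != 0. Proof. by rewrite gt_eqF. Qed.

Lemma bracket_root_mul u : bracket_root u * bracket_root (~~ u) = 1.
Proof.
by rewrite /bracket_root; case: u; case: (u0) => /=; rewrite ?mulVf ?mulfV.
Qed.

Lemma bracket_root_add u : bracket_root u + bracket_root (~~ u) = #|C|%:R.
Proof.
by rewrite card_ord -qn /bracket_root; case: u; case: (u0) => //=; rewrite addrC.
Qed.

Definition bracket_model : vertex_model R :=
  crossing_model ord0 bracket_root_mul bracket_root_add.

Section Diagram.
Variable G : closed_diagram.
Hypotheses (prior_inj : injective (@prior G)) (ad : adequate u0 G).

Definition flipped (J : {set vert G}) (c : vert G) : bool :=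
  base_state u0 c (+) (c \in J).

Definition flipped_count J := state_count n (flipped J).

(** The first change loses a loop by adequacy, each of the others gains at most one. *)
Lemma flipped_count_le J : J != set0 ->
  (n.+1 ^ 2 * flipped_count J <= n.+1 ^ #|J| * flipped_count set0)%N.
Proof.
have [k] := ubnP #|J|; elim: k J => // k IH J Jk /set0Pn[c cJ].
have out J' d : J' = J :\ c -> d != c -> flipped J d = flipped J' d.
  by move=> -> dc; rewrite /flipped !inE dc.
rewrite (cardsD1 c) cJ.
have [J1|J1] := eqVneq (J :\ c) set0.
  rewrite J1 cards0 addn0 expn1 expnS expn1 -mulnA leq_mul2l /=.
  have -> : flipped_count set0 = state_count n (@base_state u0 G).
    by apply: eq_card => e; rewrite !inE /consistent; apply: eq_forallb => d;
      rewrite /flipped inE addbF.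
  apply: (@adequate_flip _ _ _ prior_inj _ c) => //.
    by move=> d dc; rewrite (out _ _ (erefl _) dc) J1 /flipped inE addbF.
  by rewrite /flipped cJ addbT.
have lt : (#|J :\ c| < k)%N by move: Jk; rewrite (cardsD1 c) cJ.
rewrite expnD expn1 -mulnA.
apply: leq_trans (leq_mul (leqnn n.+1) (IH _ lt J1)).
rewrite mulnCA leq_mul2l /=.
by apply: (@state_count_flip _ _ _ _ c) => d; exact: out.
Qed.

Lemma flipped_count0_gt0 : (0 < flipped_count set0)%N.
Proof.
apply/card_gt0P; exists [ffun=> ord0]; rewrite inE; apply/forallP => c.
by rewrite /solution /smoothing; case: ifP; rewrite /= !ffunE eqxx.
Qed.

(** Each weight is 1 or - q, times the difference of the indicator of the preferred
    smoothing and q^-1 times that of the other one. *)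
Lemma closed_sum_states : closed_sum bracket_model (@vsign G) (@prior G) =
  (- q) ^+ heavy_number u0 G * \sum_(J : {set vert G}) (- q^-1) ^+ #|J| * (flipped_count J)%:R.
Proof.
pose I b c (e : vert G * bool -> C) : R := (solution (smoothing b c) e)%:R.
pose B := base_state u0 (G := G).
pose l c : R := if B c then 1 else - q.
have W c (e : {ffun vert G * bool -> C}) :
    weight bracket_model (vsign c) (e (prior (c, false))) (e (c, false))
      (e (prior (c, true))) (e (c, true)) =
    l c * (- q^-1 * I (~~ B c) c e + I (B c) c e).
  rewrite /= /crossing_tensor /bracket_root /l /I /B /base_state /solution.
  by case: ifP => _; rewrite /= ?andbT -!mulnb !natrM; field.
rewrite /closed_sum; under eq_bigr => e _ do
  (under eq_bigr => c _ do rewrite W; rewrite big_split bigA_distr).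
rewrite -mulr_sumr /=; congr (_ * _).
  rewrite (bigID B) /= big1 => [|c cB]; last by rewrite /l cB.
  rewrite mul1r (eq_bigr (fun=> - q)) => [|c cB]; last by rewrite /l (negbTE cB).
  by rewrite prodr_const.
rewrite exchange_big; apply: eq_bigr => J _ /=.
have P (e : {ffun vert G * bool -> C}) :
    \prod_c (if c \in J then - q^-1 * I (~~ B c) c e else I (B c) c e) =
    (- q^-1) ^+ #|J| * (consistent (flipped J) e)%:R.
  transitivity ((\prod_(c in J) (- q^-1)) * \prod_c I (flipped J c) c e).
    rewrite [X in X * _]big_mkcond -big_split; apply: eq_bigr => c _ /=.
    by rewrite /flipped -/(B c); case: ifP; rewrite ?addbT ?addbF ?mul1r.
  rewrite prodr_const; congr (_ * _).
  rewrite prod_bool; congr (nat_of_bool _)%:R.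
  by apply/allP/forallP => H c; [apply: H; rewrite mem_index_enum | move=> _; exact: H].
under eq_bigr => e _ do rewrite P.
by rewrite -mulr_sumr -natr_sum -big_mkcond /= sum1_card.
Qed.

(** A state with k > 0 changes contributes at most (N/q)^k N^-2 times the main term, N/q
    is at most 2, and m crossings have 2^m states. *)
Lemma closed_sum_lower : (2 * 4 ^ #|vert G| <= n.+1 ^ 2)%N ->
  q ^+ heavy_number u0 G <= 2 * `|closed_sum bracket_model (@vsign G) (@prior G)|.
Proof.
move=> nG.
rewrite closed_sum_states normrM normrX normrN (gtr0_norm q_gt0) mulrCA.
rewrite -[leLHS]mulr1 ler_wpM2l ?exprn_ge0 ?(ltW q_gt0) //.
set a := fun J => (flipped_count J)%:R : R.
have a0 : 1 <= a set0 by rewrite ler1n flipped_count0_gt0.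
have a0' : 0 <= a set0 by exact: le_trans a0.
have N0 : 0 < n.+1%:R ^+ 2 :> R by rewrite exprn_gt0 // ltr0n.
have N2 : n.+1%:R <= 2 * q.
  rewrite -qn mulr_natl mulr2n lerD2l.
  by apply: le_trans q1; rewrite invf_le1.
pose m := #|vert G|.
have term J : J != set0 ->
    `|(- q^-1) ^+ #|J| * a J| <= 2 ^+ m / n.+1%:R ^+ 2 * a set0.
  move=> J0; rewrite normrM normrX normrN normfV (gtr0_norm q_gt0).
  rewrite [`|a J|]ger0_norm ?ler0n //.
  have H : n.+1%:R ^+ 2 * a J <= n.+1%:R ^+ #|J| * a set0.
    by rewrite -!natrX -!natrM ler_nat flipped_count_le.
  have -> : q^-1 ^+ #|J| * a J =
      (n.+1%:R ^+ 2)^-1 * (q^-1 ^+ #|J| * (n.+1%:R ^+ 2 * a J)).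
    by rewrite mulrCA mulKf ?gt_eqF.
  rewrite [2 ^+ m / _]mulrC -[leRHS]mulrA ler_pM2l ?invr_gt0 //.
  apply: le_trans (_ : q^-1 ^+ #|J| * (n.+1%:R ^+ #|J| * a set0) <= _).
    by rewrite ler_pM2l // exprn_gt0 // invr_gt0.
  rewrite mulrA -exprMn ler_wpM2r //.
  apply: le_trans (_ : 2 ^+ #|J| <= _); last first.
    by rewrite ler_weXn2l ?ler1n //; exact: max_card.
  rewrite lerXn2r ?nnegrE ?mulr_ge0 ?invr_ge0 ?ler0n ?(ltW q_gt0) //.
  by rewrite [_ * n.+1%:R]mulrC ler_pdivrMr.
rewrite (bigD1 set0) //= cards0 expr0 mul1r -/(a set0).
set S := \sum_(J | _) _.
have HS : `|S| <= a set0 / 2.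
  apply: le_trans (ler_norm_sum _ _ _) _.
  apply: le_trans (_ : \sum_(J : {set vert G}) 2 ^+ m / n.+1%:R ^+ 2 * a set0 <= _).
    rewrite big_mkcond; apply: ler_sum => J _; case: ifP => [/term //|_].
    by rewrite !mulr_ge0 ?exprn_ge0 // invr_ge0 ltW.
  rewrite sumr_const -cardsT -powersetT card_powerset cardsT -/m -[leLHS]mulr_natl natrX.
  have key : 2 ^+ m * (2 ^+ m / n.+1%:R ^+ 2) <= 2^-1 :> R.
    rewrite mulrA ler_pdivrMr // ler_pdivlMl // -!natrX -!natrM ler_nat.
    by apply: leq_trans nG; rewrite -expnMn.
  by rewrite mulrA [leRHS]mulrC ler_wpM2r.
have : a set0 - `|S| <= `|a set0 + S|.
  by rewrite -{1}[a set0]ger0_norm // -[`|S|]normrN; rewrite -[X in `|a set0 + X|]opprK; exact: lerB_dist.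
lra.
Qed.

End Diagram.
End LowerBound.

Local Close Scope ring_scope.

(** * Orientations of state loops; adequacy of good diagrams *)

(** The orbits of a composed with b come in pairs, exchanged by a and by b, because both
    are free: on a polygon whose edges alternate between a and b, the vertices
    can be coloured alternately.  The sign records which orbit of a pair has the
    smaller root. *)
Lemma alternating_sign (T : finType) (a b : T -> T) :
  involutive a -> involutive b -> (forall d, a d != d) -> (forall d, b d != d) ->
  exists o : T -> bool, forall d, o (a d) = ~~ o d /\ o (b d) = ~~ o d.
Proof.
move=> aK bK an bn; pose phi d := b (a d).
have phi_inj : injective phi by move=> x y /(inv_inj bK)/(inv_inj aK).
have sym : connect_sym (frel phi) by exact: fconnect_sym.
have flip j x : iter j phi (a (iter j phi x)) = a x.
  elim: j x => // j IH x; rewrite iterSr -[in RHS](IH x) [iter j.+1 phi x]iterS.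
  by congr iter; rewrite /phi aK bK.
have iter_inj j : injective (iter j phi).
  by elim: j => [|j IH] x y //=; move/phi_inj/IH.
have diff d : ~~ fconnect phi d (a d).
  apply/negP => /iter_findex; move: (findex _ _ _) => k kE.
  have [j [e kj]] : exists j (e : bool), k = (j + j + e)%N.
    by exists k./2, (odd k); rewrite addnn addnC odd_double_half.
  pose y := iter j phi d.
  have : iter j phi (a y) = iter j phi (iter e phi y).
    by rewrite flip -kE kj /y -!iterD; congr iter; lia.
  move/iter_inj; case: (e) => /= E; last by have := an y; rewrite E eqxx.
  by have := bn (a y); rewrite -/(phi y) -E eqxx.
pose rk d := enum_rank (froot phi d) : nat.
have rk_eq x y : (rk x == rk y) = fconnect phi x y.
  by rewrite -(root_connect sym); apply/eqP/eqP => [/val_inj/enum_rank_inj/=|H] //; rewrite /rk H.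
have rk_b d : rk (b d) = rk (a d).
  by apply/eqP; rewrite rk_eq sym -[in b d](aK d); exact: fconnect1.
have rk_ab d : rk (a (b d)) = rk d.
  by rewrite -rk_b bK.
exists (fun d => (rk d < rk (a d))%N) => d.
rewrite aK rk_ab rk_b; split; rewrite -leqNgt ltn_neqAle rk_eq sym.
  by rewrite (negbTE (diff d)).
by rewrite (negbTE (diff d)).
Qed.

(** The polygons are the state loops: their vertices are the ends of edges, [opp] passes
    to the other end of an edge and [turn] along an arc of the state. *)
Lemma orientation_exists u0 (G : closed_diagram) : injective (@prior G) ->
  exists o : vert G * bool -> bool, orientation u0 o.
Proof.
move=> inj.
pose E := (vert G * bool * bool)%type.
pose opp (d : E) : E := if d.2 then (finv (@prior G) d.1, false) else (prior d.1, true).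
pose turn (d : E) : E :=
  ((d.1.1, ~~ d.1.2), if vsign d.1.1 == u0 then ~~ d.2 else d.2).
have oppK : involutive opp.
  by move=> [p []]; rewrite /opp /= ?f_finv ?finv_f.
have turnK : involutive turn.
  by move=> [[c s] o]; rewrite /turn /=; case: (_ == u0); rewrite !negbK.
have oppn d : opp d != d by case: d => p []; rewrite /opp /= xpair_eqE /= andbF.
have turnn d : turn d != d.
  by case: d => [[c []] []]; rewrite /turn /= !xpair_eqE /= andbF.
have [o ho] := alternating_sign oppK turnK oppn turnn.
exists (fun p => o (p, true)) => c.
have oin p : o (prior p, true) = ~~ o (p, false) by rewrite -(ho (p, false)).1.
have := ho ((c, false), false); have := ho ((c, true), false).
have := ho ((c, false), true); rewrite /turn /= !oin.
by case: ifP => _ [_ h1] [_ h2] [_ h3]; rewrite ?h1 ?h2 ?h3 ?negbK.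
Qed.

Definition closed_of (G : gauss_code) : closed_diagram :=
  ClosedDiagram (@sign G) (prev (code G)).

Lemma closed_of_inj G : full G -> injective (@prior (closed_of G)).
Proof. by case=> U M; exact: (can_inj (next_prev U)). Qed.

(** [gi] and [go] are the values before and after a passage; in contrast to [joined], the
    condition along the code is local, so it is easy to insert letters. *)
Definition code_joined u0 (G : gauss_code) (gi go : node G * bool -> bool) : Prop :=
  cycle (fun p q => go p == gi q) (code G) /\
  forall c, if sign c == u0
    then gi (c, false) = go (c, true) /\ gi (c, true) = go (c, false)
    else gi (c, false) = gi (c, true) /\ go (c, false) = go (c, true).

Definition code_adequate u0 (G : gauss_code) : Prop := forall c : node G,
  exists gi go : node G * bool -> bool,
    code_joined u0 gi go /\ gi (c, false) != go (c, false).

Lemma adequate_closed_of u0 G : full G -> code_adequate u0 G ->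
  adequate u0 (closed_of G).
Proof.
case=> U M ad c; have [gi [go [[cyc jo] ne]]] := ad c.
have gE p : gi p = go (prev (code G) p).
  by apply/eqP; rewrite eq_sym; apply: (prev_cycle cyc).
exists go; last by rewrite /= -gE.
by move=> d; rewrite /= -!gE; exact: jo.
Qed.

(** The arc of a light kink which passes straight through keeps the value of the edge on
    which the kink is placed, and the loop of the kink is a state loop of its
    own. *)
Lemma code_adequate_add_kink u0 s G :
  code_adequate u0 G -> code_adequate u0 (add_kink u0 s G).
Proof.
move=> ad [c|].
  have [gi [go [[cyc jo] ne]]] := ad c.
  pose a := if code G is p :: _ then gi p else false.
  exists (fun p => if p.1 is Some x then gi (x, p.2) else a).
  exists (fun p => if p.1 is Some x then go (x, p.2) else a).
  split=> //; split; last first.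
    by move=> [x|] /=; [exact: jo | rewrite eqxx].
  move: cyc; rewrite /a /=; case: (code G) => [|[x t] w] /=; first by rewrite ?eqxx.
  rewrite !eqxx /= !rcons_path => /andP[pw lw].
  rewrite /rename -[(Some x, t)]/((fun p : node G * bool => (Some p.1, p.2)) (x, t)).
  rewrite path_map last_map; apply/andP; split.
    by apply: sub_path pw => -[y b] [z d].
  by move: lw; case: (last _ _).
exists (fun p => (p == (None, ~~ s))).
exists (fun p => (p == (None, s))).
split; last by case: s.
split; last first.
  by move=> [x|] /=; rewrite ?eqxx; [case: ifP|case: s].
have pw w x : x != (None, s) ->
    path (fun p q : node (add_kink u0 s G) * bool => (p == (None, s)) == (q == (None, ~~ s)))
      x (rcons (rename Some w) (None, s)).
  elim: w x => [|p w IH] x xs /=; first by rewrite (negbTE xs); case: (s).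
  by rewrite (negbTE xs) /= IH.
rewrite /= pw ?andbT ?eqxx //.
by case: (s).
Qed.

Lemma full_classical_code K : full (classical_code K).
Proof.
pose f (p : crossing K * bool) : option (classical_crossing (Cl K) * bool) :=
  omap (fun c => (c, p.2)) (insub p.1).
pose g (p : classical_crossing (Cl K) * bool) : crossing K * bool := (val p.1, p.2).
have fg : ocancel f g.
  by move=> [c s]; rewrite /f /=; case: insubP => //= c' _ <-.
split; first by apply: (pmap_uniq fg); exact: passages_uniq.
move=> [c s]; rewrite /= /classical_passages mem_pmap.
apply/mapP; exists (val c, s); first exact: mem_passages.
by rewrite /= valK.
Qed.

(** The cells of colour [u0] (white if [u0 = false], black if [u0 = true]) turn at light
    crossings through the angles between an incoming and an outgoing branch, and
    at heavy crossings through those between two incoming or two outgoing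
    branches, so their boundaries are the state loops.  The indicator of one
    boundary cycle separates the two arcs at [v]. *)
Lemma good_adequate u0 K : good (Cl K) -> code_adequate u0 (classical_code K).
Proof.
move=> gd v; have [U M] := full_classical_code K.
pose V := atom_of (Cl K).
pose step := @boundary_step V u0.
have oppK : involutive (@diagram_opposite (Cl K)).
  move=> [c [s []]]; rewrite /diagram_opposite /=.
    by rewrite -surjective_pairing prev_next.
  by rewrite -surjective_pairing next_prev.
have step_sym : connect_sym step.
  apply: sym_connect_sym => d d'; rewrite /step /boundary_step.
  congr (_ || _); first by apply/eqP/eqP => ->; exact/esym/oppK.
  by apply: eq_existsb => c; rewrite orbC.
have step_eq d x y : step x y -> connect step d x = connect step d y.
  move=> xy; apply: same_connect_r => //; exact: connect1.
have angle_eq d c : forall a, a \in @angles V u0 c ->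
    connect step d a.1 = connect step d a.2.
  move=> [x y] xy; apply: step_eq; rewrite /step /boundary_step.
  by apply/orP; right; apply/existsP; exists c; rewrite xy.
pose x := diagram_enum v.
(* The two angles at [v] of the colour [u0]. *)
pose a1 := if u0 then (x 1, x 2) else (x 2, x 3).
pose a2 := if u0 then (x 3, x 4) else (x 4, x 1).
have ang : @angles V u0 v = [:: a1; a2] by rewrite /angles /a1 /a2; case: (u0).
have ncon : ~~ connect step a1.1 a2.1.
  move: (gd v); rewrite cat_uniq => /and3P[ub _ uw].
  have : uniq [seq cell_at u0 a | a <- @angles V u0 v] by case: (u0).
  rewrite ang /= inE andbT; apply: contra => con; apply/eqP.
  congr (_, _); apply/setP => d; rewrite !inE.
  exact: (same_connect step_sym).
pose g := connect step a1.1.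
exists (fun p => g (p.1, (p.2, false))), (fun p => g (p.1, (p.2, true))).
split; first split.
- apply: cycle_from_next => // -[c s] _ /=; apply/eqP; apply: step_eq.
  by rewrite /step /boundary_step; apply/orP; left; rewrite /= /diagram_opposite /=.
- move=> c.
  have := angle_eq a1.1 c; rewrite /angles /= /diagram_enum /= -/g.
  rewrite /under_strand /over_strand; have := valP c.
  case: (kind (val c)) => // sg _.
  case: (u0) => H; have := H _ (mem_head _ _);
    have {H} := H _ (mem_last _ _); rewrite /= -/g.
    by case: sg; rewrite /cw_branch /= => h1 h2; split.
  by case: sg; rewrite /cw_branch /= => h1 h2; split.
have g1 : g a1.1 = true by exact: connect0.
have g2 : g a1.2 = true by rewrite -g1 /g -(angle_eq _ v a1) // ang mem_head.
have g3 : g a2.1 = false by exact: negbTE.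
have g4 : g a2.2 = false by rewrite -g3 /g -(angle_eq _ v a2) // ang !inE eqxx orbT.
move: g1 g2 g3 g4; rewrite /a1 /a2 /x /diagram_enum /under_strand.
have := valP v; move: g; case: (kind (val v)) => // sg g _.
by case: (u0); case: sg; rewrite /cw_branch /= => h1 h2 h3 h4;
  rewrite ?h1 ?h2 ?h3 ?h4.
Qed.

Local Open Scope ring_scope.

(** * Comparison of heavy crossings *)

Section Bounds.
Variables (R : realFieldType) (u0 : bool).

(** The heavy weight is bounded after reversal of one strand, which makes it a
    multiple of a contraction. *)
Definition bounded (l : R) (V : vertex_model R) : Prop :=
  norm_le 1 (weight V u0) /\ norm_le l (reverse2 (weight V (~~ u0))).

Lemma bounded_two_cable l V : bounded l V -> bounded (l ^+ 4) (two_cable_model V).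
Proof.
case=> H1 H2; split; first by rewrite -(expr1n R 4); exact: norm_le_two_cable.
by rewrite /= reverse2_two_cable; exact: norm_le_two_cable.
Qed.

Lemma closed_sum_upper l V G : bounded l V ->
  `|closed_sum V (@vsign G) (@prior G)| <=
  #|color V|%:R ^+ (2 * #|vert G|) * l ^+ heavy_number u0 G.
Proof.
case=> H1 H2.
apply: le_trans (ler_norm_sum _ _ _) _.
apply: le_trans (_ : \sum_(e : {ffun vert G * bool -> color V}) l ^+ heavy_number u0 G <= _).
  apply: ler_sum => e _; rewrite normr_prod.
  have -> : l ^+ heavy_number u0 G = \prod_(c : vert G) (if vsign c != u0 then l else 1).
    by rewrite -big_mkcond prodr_const.
  apply: ler_prod => c _; rewrite normr_ge0 /=.
  have [cu|cu] /= := eqVneq (vsign c) u0; first by rewrite cu; exact: entry_le.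
  have -> : vsign c = ~~ u0 by move: cu; case: (vsign c); case: (u0).
  exact: (entry_le _ _ _ _ H2).
rewrite sumr_const card_ffun card_prod card_bool [(_ * 2)%N]mulnC -[leLHS]mulr_natl natrX.
by [].
Qed.

End Bounds.

Section Iterate.
Variables (R : realFieldType) (u0 : bool).

Lemma closed_sum_iter r (V : vertex_model R) G :
  closed_sum (iter r (@two_cable_model R) V) (@vsign G) (@prior G) =
  closed_sum V (@vsign (iter r cable G)) (@prior (iter r cable G)).
Proof.
elim: r G => // r IH G.
by rewrite [iter _ _ V]/= closed_sum_cable (IH (cable G)) -iterSr.
Qed.

Lemma bounded_iter r l (V : vertex_model R) : bounded u0 l V ->
  bounded u0 (l ^+ (4 ^ r)) (iter r (@two_cable_model R) V).
Proof.
move=> H; elim: r => [|r IH]; first by rewrite expn0 expr1.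
by rewrite expnSr exprM; exact: bounded_two_cable.
Qed.

Lemma card_color_iter r (V : vertex_model R) :
  #|color (iter r (@two_cable_model R) V)| = (#|color V| ^ (2 ^ r))%N.
Proof.
elim: r => [|r IH]; first by rewrite expn1.
by rewrite [LHS]/= card_prod IH -expnD addnn -mul2n -expnS.
Qed.

Lemma heavy_number_iter r G : heavy_number u0 (iter r cable G) = (4 ^ r * heavy_number u0 G)%N.
Proof.
elim: r => [|r IH]; first by rewrite mul1n.
by rewrite [iter _ _ _]/= heavy_number_cable IH expnS mulnA.
Qed.

Lemma adequate_iter r G : injective (@prior G) -> adequate u0 G ->
  injective (@prior (iter r cable G)) /\ adequate u0 (iter r cable G).
Proof.
move=> inj ad; elim: r => [//|r [injr adr]].
split; first exact: cable_prev_inj.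
by have [o ho] := orientation_exists u0 injr; exact: (cable_adequate ho).
Qed.

End Iterate.

Section Comparison.
Variable u0 : bool.

(** The larger root of x^2 - N x + 1. *)
Lemma large_loop_root (R : rcfType) (n : nat) : (2 <= n.+1)%N ->
  exists q : R, [/\ 1 <= q, q + q^-1 = n.+1%:R & n.+1%:R <= 2 * q].
Proof.
move=> n2; set N : R := n.+1%:R.
have N2 : 2 <= N by rewrite (ler_nat _ 2).
pose s := Num.sqrt (N ^+ 2 - 4).
have s0 : 0 <= s by exact: sqrtr_ge0.
have s2 : s ^+ 2 = N ^+ 2 - 4 by rewrite sqr_sqrtr //; nra.
exists ((N + s) / 2); split; [lra| |lra].
have q0 : (N + s) / 2 != 0 by rewrite gt_eqF //; lra.
apply: (mulfI q0); rewrite mulrDr mulfV //.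
have -> : (N + s) / 2 * N = ((N + s) / 2) * ((N + s) / 2) + (N ^+ 2 - s ^+ 2) / 4 by field.
by rewrite s2; field.
Qed.

(** The parameters are chosen in this order: r depends on the number of crossings of [H],
    and the number of colours on r and on both diagrams. *)
Lemma heavy_number_le (G H : closed_diagram) :
  injective (@prior G) -> adequate u0 G ->
  (forall V : vertex_model realalg,
     closed_sum V (@vsign G) (@prior G) = closed_sum V (@vsign H) (@prior H)) ->
  (heavy_number u0 G <= heavy_number u0 H)%N.
Proof.
move=> inj ad eqZ; rewrite leqNgt; apply/negP => lt.
pose h := #|vert H|; pose r := (2 * h).+1.
pose B := (2 * 2 ^ (2 ^ r * (2 * h)))%N.
pose n := (2 * B + 2 * 4 ^ #|vert (iter r cable G)|)%N.
have [|q [q1 qn nq]] := @large_loop_root realalg n.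
  by rewrite ltnS /n /B; lia.
pose V := iter r (@two_cable_model _) (bracket_model u0 q1 qn).
have q0 : 0 < q by exact: lt_le_trans ltr01 q1.
have [injr adr] := adequate_iter r inj ad.
have low : q ^+ (4 ^ r * heavy_number u0 G) <= 2 * `|closed_sum V (@vsign G) (@prior G)|.
  rewrite -heavy_number_iter closed_sum_iter; apply: closed_sum_lower => //.
  rewrite /n; nia.
have bd : bounded u0 (q ^+ (4 ^ r)) V.
  apply: bounded_iter; split.
    rewrite /= /bracket_root eqxx; apply: norm_le_light => //; by rewrite card_ord.
  rewrite /= /bracket_root; case: (u0) => /=; apply: norm_le_heavy => //;
  by rewrite card_ord.
have up := closed_sum_upper H bd.
rewrite -eqZ card_color_iter card_ord -/h -exprM in up.
have {low up} : q ^+ (4 ^ r * heavy_number u0 G) <=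
    2 * ((n.+1 ^ 2 ^ r)%:R ^+ (2 * h) * q ^+ (4 ^ r * heavy_number u0 H)).
  by apply: le_trans low _; rewrite ler_pM2l.
apply/negP; rewrite -ltNge natrX -exprM; set e := (2 ^ r * (2 * h))%N.
have le1 : q ^+ (4 ^ r * heavy_number u0 H) * (q ^+ e * q) <=
    q ^+ (4 ^ r * heavy_number u0 G).
  rewrite -exprSr -exprD ler_weXn2l //.
  have : (r < 2 ^ r)%N by exact: ltn_expl.
  have -> : (4 ^ r = 2 ^ r * 2 ^ r)%N by rewrite -expnMn.
  rewrite /e /r; nia.
have pos k : 0 < q ^+ k by exact: exprn_gt0.
apply: lt_le_trans le1; rewrite mulrA mulrC ltr_pM2l //.
have le2 : n.+1%:R ^+ e <= (2 * q) ^+ e :> realalg.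
  by apply: lerXn2r => //; rewrite nnegrE ?ler0n // mulr_ge0 // ltW.
apply: le_lt_trans (_ : 2 * (2 * q) ^+ e < _); first by rewrite ler_pM2l.
rewrite exprMn mulrA mulrC ltr_pM2l //.
have Bq : B%:R < q.
  rewrite -(ltr_pM2l (x := 2)) //; apply: lt_le_trans nq.
  rewrite -natrM ltr_nat ltnS /n; exact: leq_addr.
by apply: le_lt_trans Bq; rewrite /B natrM natrX.
Qed.

End Comparison.

Section Main.
Variable u0 : bool.

Definition add_kinks (l : seq bool) (G : gauss_code) := foldr (add_kink u0) G l.

Lemma full_add_kinks l G : full G -> full (add_kinks l G).
Proof. by elim: l => //= s l IH /IH; exact: full_add_kink. Qed.

Lemma code_matrix_add_kinks (R : comNzRingType) (V : vertex_model R) l G : full G ->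
  code_matrix V (add_kinks l G) = kmul (kinks V u0 l) (code_matrix V G).
Proof.
move=> fG; elim: l => [|s l IH] /=; first by rewrite kmul1k.
by rewrite code_matrix_add_kink ?IH ?kmulA //; exact: full_add_kinks.
Qed.

Lemma code_adequate_add_kinks l G :
  code_adequate u0 G -> code_adequate u0 (add_kinks l G).
Proof. by move=> H; elim: l => //= s l IH; exact: code_adequate_add_kink. Qed.

Lemma heavy_number_add_kinks l G :
  heavy_number u0 (closed_of (add_kinks l G)) = heavy_number u0 (closed_of G).
Proof.
elim: l => //= s l <-; rewrite /heavy_number.
rewrite -[RHS](card_image (f := Some)); last by move=> x y [].
apply: eq_card => -[c|]; rewrite !inE /=.
  by rewrite mem_image ?inE //; move=> x y [].
by rewrite eqxx; apply/esym/negbTE/negP => /imageP[].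
Qed.

(** One more kink on both sides makes the codes nonempty, as required for closing them
    up. *)
Lemma heavy_number_good (K1 K2 : long_diagram) : good (Cl K1) ->
  long_equivalent K1 K2 ->
  (heavy_number u0 (closed_of (classical_code K1)) <=
   heavy_number u0 (closed_of (classical_code K2)))%N.
Proof.
move=> gd eqv.
have [f1 f2] := (full_classical_code K1, full_classical_code K2).
have [k1 [k2 kE]] := long_equivalent_matrix realalg u0 eqv.
pose G1 := add_kinks (false :: k1) (classical_code K1).
pose G2 := add_kinks (false :: k2) (classical_code K2).
have F1 : full G1 by exact: full_add_kinks.
have F2 : full G2 by exact: full_add_kinks.
rewrite -(heavy_number_add_kinks (false :: k1) (classical_code K1)).
rewrite -(heavy_number_add_kinks (false :: k2) (classical_code K2)).
apply: (heavy_number_le (closed_of_inj F1)) => [|V].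
  apply: adequate_closed_of => //; apply: code_adequate_add_kinks.
  exact: good_adequate gd.
rewrite -!trace_code_matrix //; apply: eq_bigr => a _; congr (_ a a).
rewrite !code_matrix_add_kinks // -!diagram_matrix_classical.
by rewrite /= -!kmulA kE.
Qed.

End Main.

Lemma classical_number_heavy (K : long_diagram) :
  classical_number K = (heavy_number true (closed_of (classical_code K)) +
    heavy_number false (closed_of (classical_code K)))%N.
Proof.
rewrite /classical_number -card_sig.
rewrite -[LHS](cardC [pred c : node (classical_code K) | sign c]) addnC.
congr (_ + _)%N; apply: eq_card => c; rewrite !inE /=; by case: over_strand.
Qed.

Local Close Scope ring_scope.

Theorem theorem3 (K1 : long_diagram) (K1_good : good (Cl K1))
    (K2 : long_diagram) (K1_K2 : long_equivalent K1 K2) :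
  classical_number K1 <= classical_number K2.
Proof.
by rewrite !classical_number_heavy leq_add // heavy_number_good.
Qed.
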